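(* Let $M^{m+1}$ be a Riemannian manifold of dimension $m+1$, let $N^m\subset M^{m+1}$ be an orientable hypersurface, let $\alpha:I\to N^m\subset M^{m+1}$ be a regular curve parametrized by arc length, and let $\{\mathbf{t},\mathbf{n}_1,\dots,\mathbf{n}_m\}$ be a rotation minimizing frame along $\alpha$ in $M$, with associated curvatures $\kappa_1,\dots,\kappa_m$. If $N$ is a totally geodesic hypersurface of $M$, then the normal development curve $(\kappa_1,\dots,\kappa_m)$ lies on a hyperplane of $\mathbb{R}^m$ passing through the origin (a line through the origin when $m=2$); that is, there exist real constants $a_1,\dots,a_m$, not all zero, such that $\sum_{i=1}^m a_i\kappa_i(s)=0$ for all $s\in I$.
   Context: $\nabla$ is the Levi-Civita connection of $M$, $I\subseteq\mathbb{R}$ is an interval, and $\mathbf{t}=\alpha'$ is the unit tangent. A rotation minimizing (RM) frame along $\alpha$ is an orthonormal frame $\{\mathbf{t},\mathbf{n}_1,\dots,\mathbf{n}_m\}$ of $T_{\alpha(s)}M$ along $\alpha$ such that $\nabla_{\mathbf{t}}\mathbf{t}=\sum_{i=1}^m\kappa_i\mathbf{n}_i$ and $\nabla_{\mathbf{t}}\mathbf{n}_i=-\kappa_i\mathbf{t}$ for $1\le i\le m$. The curve $s\mapsto(\kappa_1(s),\dots,\kappa_m(s))\in\mathbb{R}^m$ is called the normal development of $\alpha$. A submanifold $N\subset M$ is totally geodesic if every geodesic of $N$ (with the induced metric) is also a geodesic of $M$. *)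

(* Defs.v *)
(* Differential geometry in charts, in the classical tensor-component style: a manifold carries an
   atlas, and a tensor at a point p is a family of component arrays indexed by
   the charts at p and obeying the usual transformation law.  Vectors are row
   vectors, so a differential acts by multiplication on the right. *)
From HB Require Import structures.
From mathcomp Require Import all_boot all_order all_algebra.
From mathcomp Require Import all_classical all_reals all_analysis.
From mathcomp Require Import ring.

Set Implicit Arguments.
Unset Strict Implicit.
Unset Printing Implicit Defensive.

Import Order.TTheory GRing.Theory Num.Theory.
Import numFieldNormedType.Exports.

Local Open Scope classical_set_scope.
Local Open Scope ring_scope.

Section Calculus.
Variable R : realType.

Definition partial n (i : 'I_n) (f : 'rV[R]_n -> R) : 'rV[R]_n -> R :=
  fun x => 'D_(delta_mx 0 i) f x.

(* Meaningful for open U; elsewhere the partial derivatives see f outside U. *)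
Fixpoint Ck n (k : nat) (U : set 'rV[R]_n) (f : 'rV[R]_n -> R) : Prop :=
  {within U, continuous f} /\
  if k is k'.+1 then
    forall i : 'I_n, (forall x, U x -> derivable f x (delta_mx 0 i)) /\
                     Ck k' U (partial i f)
  else True.

Definition smooth_on n (U : set 'rV[R]_n) (f : 'rV[R]_n -> R) : Prop :=
  forall k, Ck k U f.

Definition nondegenerate_interval (I : set R) : Prop :=
  is_interval I /\ exists a b, [/\ I a, I b & a < b].

(* Derivatives relative to I: one-sided at the end points belonging to I. *)
Definition diff_quot (f : R -> R) (s u : R) : R := (f u - f s) / (u - s).

Definition derivable_in (I : set R) (f : R -> R) (s : R) : Prop :=
  cvg (diff_quot f s u @[u --> within I s^']).

Definition derive_in (I : set R) (f : R -> R) (s : R) : R :=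
  lim (diff_quot f s u @[u --> within I s^']).

(* Iterated derivatives only depend on the germ of f at s in I, provided they
   exist at every nearby point of I; this is always used at all points s of a
   relatively open subset of I. *)
Definition smooth_in_at (I : set R) (f : R -> R) (s : R) : Prop :=
  forall k, derivable_in I (iter k (derive_in I) f) s.

End Calculus.

Section Charts.
Variable R : realType.

(* [coord] and [param] are inverse homeomorphisms between [dom] and its image;
   their values elsewhere are irrelevant. *)
Record chart (n : nat) (M : topologicalType) := Chart {
  dom : set M;
  coord : M -> 'rV[R]_n;
  param : 'rV[R]_n -> M;
  dom_open : open dom;
  image_open : open (coord @` dom);
  coordK : forall p, dom p -> param (coord p) = p;
  coord_continuous : {within dom, continuous coord};
  param_continuous : {within coord @` dom, continuous param}
}.

Section TwoSpaces.
Variables (n n' : nat) (M M' : topologicalType).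
Variables (f : M -> M') (c : chart n M) (d : chart n' M').

Definition local_rep (j : 'I_n') : 'rV[R]_n -> R :=
  fun x => coord d (f (param c x)) 0 j.

Definition smooth_rep : Prop :=
  forall j, smooth_on (coord c @` (dom c `&` f @^-1` dom d)) (local_rep j).

(* The differential of f at p: u has image u *m jac p. *)
Definition jac (p : M) : 'M[R]_(n, n') :=
  \matrix_(i, j) partial i (local_rep j) (coord c p).

End TwoSpaces.

Definition compatible n (M : topologicalType) (c d : chart n M) : Prop :=
  smooth_rep id c d /\ smooth_rep id d c.

End Charts.

Record manifold (R : realType) (n : nat) := Manifold {
  carrier :> topologicalType;
  atlas : set (chart R n carrier);
  manifold_hausdorff : hausdorff_space carrier;
  manifold_second_countable : @second_countable carrier;
  atlas_cover : forall p : carrier, exists2 c, atlas c & dom c p;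
  atlas_compatible : forall c d, atlas c -> atlas d -> compatible c d
}.

Definition charts_at R n (M : manifold R n) (p : M) : set (chart R n M) :=
  [set c | atlas c /\ dom c p].

Definition smooth_map R n n' (M : manifold R n) (M' : manifold R n')
    (f : M -> M') : Prop :=
  continuous f /\
  forall c d, @atlas _ _ M c -> @atlas _ _ M' d -> smooth_rep f c d.

(* The oriented atlas may use any charts of the smooth structure, not only the
   ones of the given (not necessarily maximal) atlas. *)
Definition orientable R n (M : manifold R n) : Prop :=
  exists A : set (chart R n M),
    [/\ forall c d, A c -> @atlas _ _ M d -> compatible c d,
        forall p : M, exists2 c, A c & dom c p &
        forall c d p, A c -> A d -> dom c p -> dom d p ->
          0 < \det (jac id c d p)].

(* [gram c p] is the matrix of the scalar product of T_pM in the basis of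
   coordinate vectors of the chart c. *)
Record metric (R : realType) (n : nat) (M : manifold R n) := Metric {
  gram : chart R n M -> M -> 'M[R]_n;
  gram_smooth : forall c i j, atlas c ->
    smooth_on (coord c @` dom c) (fun x => gram c (param c x) i j);
  gram_change : forall c d p, charts_at p c -> charts_at p d ->
    gram c p = jac id c d p *m gram d p *m (jac id c d p)^T;
  gram_sym : forall c p, charts_at p c -> (gram c p)^T = gram c p;
  gram_pos : forall c p (u : 'rV[R]_n), charts_at p c -> u != 0 ->
    0 < (u *m gram c p *m u^T) 0 0
}.

Section RiemannianManifold.
Variables (R : realType) (n : nat) (M : manifold R n) (g : metric M).

Definition tvec : Type := chart R n M -> 'rV[R]_n.

Definition is_tangent (p : M) (v : tvec) : Prop :=
  forall c d, charts_at p c -> charts_at p d -> v d = v c *m jac id c d p.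

Definition inner (c : chart R n M) (p : M) (u v : tvec) : R :=
  (u c *m gram g c p *m (v c)^T) 0 0.

(* \partial_i g_jk *)
Definition dgram (c : chart R n M) (p : M) (i j k : 'I_n) : R :=
  partial i (fun x => gram g c (param c x) j k) (coord c p).

(* \Gamma^k_ij *)
Definition christoffel (c : chart R n M) (p : M) (i j k : 'I_n) : R :=
  2^-1 * \sum_l invmx (gram g c p) k l *
    (dgram c p i j l + dgram c p j i l - dgram c p l i j).

(* Torsion-freeness and compatibility with the metric of the connection with
   \nabla_(\partial_i) \partial_j = \sum_k G i j k \partial_k at p. *)
Definition levi_civita_at (c : chart R n M) (p : M)
    (G : 'I_n -> 'I_n -> 'I_n -> R) : Prop :=
  (forall i j k, G i j k = G j i k) /\
  (forall i j k, dgram c p i j k =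
     \sum_l (G i j l * gram g c p l k + G i k l * gram g c p j l)).

Lemma dgramC c p i j k : charts_at p c -> dgram c p i j k = dgram c p i k j.
Proof.
move=> [cM cp]; rewrite /dgram /partial; apply: near_eq_derive.
have : nbhs (coord c p) (coord c @` dom c).
  by apply: open_nbhs_nbhs; split; [exact: image_open | exists p].
apply: filterS => _ [q cq <-]; rewrite coordK //.
by rewrite -[in LHS](@gram_sym _ _ _ g c q) ?mxE.
Qed.

Lemma gram_unit c p : charts_at p c -> gram g c p \in unitmx.
Proof.
move=> cp; rewrite -row_free_unit -kermx_eq0; apply/eqP/row_matrixP => i.
rewrite row0; apply/eqP; apply: contraT => /(gram_pos g cp).
by rewrite -row_mul mulmx_ker row0 mul0mx mxE ltxx.
Qed.

(* Existence and uniqueness of the Levi-Civita connection, in a chart. *)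
Lemma christoffelP c p G : charts_at p c ->
  levi_civita_at c p G <-> forall i j k, G i j k = christoffel c p i j k.
Proof.
move=> cp; have gU := gram_unit cp.
have gC a b : gram g c p a b = gram g c p b a.
  by rewrite -[in LHS](gram_sym g cp) mxE.
pose K i j k := dgram c p i j k + dgram c p j i k - dgram c p k i j.
have chE i j :
    \row_k christoffel c p i j k = (\row_k (2^-1 * K i j k)) *m invmx (gram g c p).
  apply/rowP => k; rewrite !mxE /christoffel mulr_sumr; apply: eq_bigr => l _.
  rewrite !mxE (_ : invmx _ l k = invmx (gram g c p) k l) ?/K; first by ring.
  by rewrite -[in LHS](gram_sym g cp) -trmx_inv mxE.
have chS i j k :
    \sum_l christoffel c p i j l * gram g c p l k = 2^-1 * K i j k.
  have /(congr1 (mulmx^~ (gram g c p))) := chE i j.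
  rewrite mulmxKV // => /rowP/(_ k); rewrite !mxE => <-.
  by apply: eq_bigr => l _; rewrite mxE.
split=> [[Gs Gm] i j k|GE].
  pose L a b d := \sum_q G a b q * gram g c p q d.
  have LC a b d : L a b d = L b a d by apply: eq_bigr => q _; rewrite Gs.
  have dE a b d : dgram c p a b d = L a b d + L a d b.
    by rewrite Gm big_split; congr (_ + _); apply: eq_bigr => q _; rewrite gC.
  have : (\row_l G i j l) *m gram g c p = \row_k (2^-1 * K i j k).
    apply/rowP => l; rewrite !mxE.
    transitivity (L i j l); first by apply: eq_bigr => q _; rewrite mxE.
    by rewrite /K !dE (LC j i) (LC l i) (LC l j); field.
  move=> /(congr1 (mulmx^~ (invmx (gram g c p)))); rewrite mulmxK // -chE.
  by move=> /rowP/(_ k); rewrite !mxE.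
split=> i j k.
  rewrite !GE /christoffel; congr (_ * _); apply: eq_bigr => l _.
  by rewrite [dgram c p i j l + _]addrC (dgramC l i j cp).
under eq_bigr do rewrite !GE.
rewrite big_split /= chS.
under eq_bigr do rewrite gC.
rewrite chS /K (dgramC i k j cp) (dgramC j i k cp) (dgramC k i j cp).
by field.
Qed.

Section AlongCurve.
Variables (I : set R) (gam : R -> M).

Definition smooth_curve : Prop :=
  {within I, continuous gam} /\
  forall s c, I s -> charts_at (gam s) c ->
    forall j, smooth_in_at I (fun u => coord c (gam u) 0 j) s.

Definition velocity (s : R) : tvec :=
  fun c => \row_j derive_in I (fun u => coord c (gam u) 0 j) s.

Definition unit_speed : Prop :=
  forall s c, I s -> charts_at (gam s) c ->
    inner c (gam s) (velocity s) (velocity s) = 1.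

Definition smooth_field (V : R -> tvec) : Prop :=
  forall s, I s -> is_tangent (gam s) (V s) /\
    forall c, charts_at (gam s) c ->
      forall j, smooth_in_at I (fun u => V u c 0 j) s.

(* The Levi-Civita covariant derivative of V along gam. *)
Definition cov_derive (V : R -> tvec) (s : R) : tvec :=
  fun c => \row_k (derive_in I (fun u => V u c 0 k) s +
    \sum_i \sum_j christoffel c (gam s) i j k *
                  velocity s c 0 i * V s c 0 j).

Definition geodesic : Prop :=
  [/\ nondegenerate_interval I, smooth_curve &
      forall s c, I s -> charts_at (gam s) c -> cov_derive velocity s c = 0].

End AlongCurve.
End RiemannianManifold.

(* N immersed injectively in M by the inclusion iota, with the topology and
   smooth structure of N; embedded submanifolds are a particular case. *)
Definition submanifold R n n' (N : manifold R n) (M : manifold R n')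
    (iota : N -> M) : Prop :=
  [/\ injective iota, smooth_map iota &
      forall p c d, charts_at p c -> charts_at (iota p) d ->
        row_free (jac iota c d p)].

Definition induced_metric R n n' (N : manifold R n) (M : manifold R n')
    (iota : N -> M) (g : metric M) (h : metric N) : Prop :=
  forall p c d, charts_at p c -> charts_at (iota p) d ->
    gram h c p = jac iota c d p *m gram g d (iota p) *m (jac iota c d p)^T.

Definition totally_geodesic R n n' (N : manifold R n) (M : manifold R n')
    (iota : N -> M) (g : metric M) (h : metric N) : Prop :=
  forall (J : set R) (gam : R -> N),
    geodesic h J gam -> geodesic g J (iota \o gam).

(* The frame consists of the velocity t of gam and of the fields nu i; it is a
   basis since the dimension is m + 1. *)
Definition rm_frame R m (M : manifold R m.+1) (g : metric M)
    (I : set R) (gam : R -> M)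
    (nu : 'I_m -> R -> tvec M) (kappa : 'I_m -> R -> R) : Prop :=
  let t := velocity I gam in
  (forall i, smooth_field I gam (nu i)) /\
  forall s c, I s -> charts_at (gam s) c ->
    [/\ inner g c (gam s) (t s) (t s) = 1,
        forall i, inner g c (gam s) (t s) (nu i s) = 0,
        forall i j, inner g c (gam s) (nu i s) (nu j s) = (i == j)%:R,
        cov_derive g I gam t s c = \sum_i kappa i s *: nu i s c &
        forall i, cov_derive g I gam (nu i) s c = - kappa i s *: t s c].

(* Main.v *)
Require Import Defs.
From HB Require Import structures.
From mathcomp Require Import all_boot all_order all_algebra.
From mathcomp Require Import all_classical all_reals all_analysis.
From mathcomp Require Import ring lra.
Require Import Defs.

(** Let t be the velocity of the curve and xi = a_1 n_1 + ... + a_m n_m a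
    combination of the frame with constant coefficients.  The equations of the
    frame give
      nabla_t xi = - k t   and   k = <nabla_t t, xi>,
    where k = a_1 kappa_1 + ... + a_m kappa_m.  In a totally geodesic N the
    vector nabla_t t is tangent to N; so k vanishes as soon as xi is normal to
    N, and the theorem follows once constants a_i, not all zero, are found
    for which xi is normal to N at every point of the curve.

    At one point they come from linear algebra: the m x m matrix of the scalar
    products of n_1, ..., n_m with the coordinate vectors e_1, ..., e_m of a
    chart of N kills the coordinates of t, which is a nonzero vector tangent to
    N and orthogonal to all the n_i; hence some a <> 0 kills it from the other
    side.  Normality then spreads along the curve ([normal_transport]): the row
    F of the scalar products F_b = <xi, e_b> satisfies a linear system F' = F B,
    because nabla_t e_b is tangent to N, because <xi, nabla_t e_b> is therefore
    a combination of the F_b, and because k is one too.  A solution of such a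
    system that vanishes somewhere vanishes nearby ([linear_ode_zero]), and an
    interval is connected ([interval_propagation]).

    What has to be extracted from the hypothesis on N is that the second
    fundamental form vanishes ([totally_geodesic_second_form]).  The hypothesis
    speaks of geodesics, so one needs a geodesic of N with a prescribed initial
    velocity v ([exists_geodesic]); comparing its equations in N and in M gives
    the vanishing of the form on (v, v), and its symmetry does the rest.  The
    geodesic is obtained in one chart by Picard iteration ([picard]); that it
    satisfies the geodesic equation in all the other charts is the
    transformation law of the Christoffel symbols ([christoffel_change]), which
    is deduced from the uniqueness of the Levi-Civita connection.

    In charts everything is matrix algebra on row vectors.  Along a curve with
    velocity z, a field X has the covariant derivative X' + X *m conn z; and
    a map with Jacobian matrix J carries X to the field X *m J, whose covariant
    derivative is (X' + X *m conn v) *m J + X *m second_form v, where v is the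
    velocity of the curve in the source.  The change of charts and the inclusion
    of N in M are both treated by this formula, mostly for X = v
    ([cov_derive_velocity_map]). *)

Set Implicit Arguments.
Unset Strict Implicit.
Unset Printing Implicit Defensive.

Import Order.TTheory GRing.Theory Num.Theory.
Import numFieldNormedType.Exports.

Local Open Scope classical_set_scope.
Local Open Scope ring_scope.

(** * Limits of families and of matrices *)

Section Filters.
Variables (R : realType) (T : Type) (F : set_system T).
Hypothesis FF : Filter F.

Lemma cvg_fsum (J : finType) (f : J -> T -> R) (l : J -> R) :
  (forall j, f j u @[u --> F] --> l j) ->
  (\sum_j f j u) @[u --> F] --> \sum_j l j.
Proof.
move=> fl; elim: (index_enum J) => [|j r ih].
  under eq_cvg do rewrite big_nil.
  by rewrite big_nil; exact: cvg_cst.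
under eq_cvg do rewrite big_cons.
by rewrite big_cons; apply: cvgD.
Qed.

Lemma cvg_mx m n (f : T -> 'M[R]_(m, n)) (l : 'M[R]_(m, n)) :
  (forall i j, f u i j @[u --> F] --> l i j) -> f u @[u --> F] --> l.
Proof.
move=> fl; apply/cvg_ballP => e e0.
have : \forall u \near F, forall ij : 'I_m * 'I_n,
    ball (l ij.1 ij.2) e (f u ij.1 ij.2).
  by apply: filter_forall => ij; move/cvg_ballP: (fl ij.1 ij.2) => /(_ _ e0).
apply: filterS => u fu; split=> // i j; exact: (fu (i, j)).
Qed.

Lemma cvg_entry m n (f : T -> 'M[R]_(m, n)) (l : 'M[R]_(m, n)) i j :
  f u @[u --> F] --> l -> f u i j @[u --> F] --> l i j.
Proof.
move=> fl; apply: (cvg_comp _ (fun M : 'M[R]_(m, n) => M i j) fl).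
exact: matrix_normedtype.coord_continuous.
Qed.

Lemma cvg_mulmx m n p (f : T -> 'M[R]_(m, n)) (g : T -> 'M[R]_(n, p))
    (a : 'M[R]_(m, n)) (b : 'M[R]_(n, p)) :
  f u @[u --> F] --> a -> g u @[u --> F] --> b ->
  (f u *m g u) @[u --> F] --> a *m b.
Proof.
move=> fa gb; apply: cvg_mx => i k.
under eq_cvg do rewrite mxE.
rewrite mxE; apply: cvg_fsum => j.
by apply: cvgM; exact: cvg_entry.
Qed.

Lemma mx_entry_le_norm m n (A : 'M[R]_(m, n)) i j : `|A i j| <= `|A|.
Proof.
by rewrite [`|A|]mx_normrE; apply/bigmax_geP; right => /=; exists (i, j).
Qed.

Lemma cvg_mx_bounded m n (A : T -> 'M[R]_(m, n)) (A0 : 'M[R]_(m, n)) :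
  A u @[u --> F] --> A0 ->
  exists2 K, 0 <= K & \forall u \near F, forall i j, `|A u i j| <= K.
Proof.
move=> AA0; exists (`|A0| + 1); first by rewrite addr_ge0.
have := @cvgr_dist_lt _ _ _ _ FF _ _ AA0 _ ltr01; apply: filterS => u Au i j.
apply: le_trans (mx_entry_le_norm _ _ _) _.
by have := ler_normD (A u - A0) A0; rewrite subrK distrC; move: Au; lra.
Qed.

End Filters.

(** * Derivatives relative to an interval *)

Section DerivativeIn.
Variables (R : realType) (I : set R).
Implicit Types (f g : R -> R) (s l : R).

(** The relational form of [derive_in]: all computations are made with it, and
    the value of [derive_in] is read off at the end. *)
Definition has_derive_in f s l := diff_quot f s u @[u --> within I s^'] --> l.

Lemma near_dnbhs_in s (P : set R) :
  (\forall u \near within I (nbhs s), P u) -> \forall u \near within I s^', P u.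
Proof. by rewrite !near_withinE; apply: filterS => u h _; exact: h. Qed.

Lemma neq_dnbhs_in s : \forall u \near within I s^', u != s.
Proof.
rewrite near_withinE near_withinE; apply: nearW => u us _; exact: us.
Qed.

Lemma has_derive_in_near f g s l : I s ->
  (\forall u \near within I (nbhs s), f u = g u) ->
  has_derive_in f s l -> has_derive_in g s l.
Proof.
move=> Is fg; apply: cvg_trans; apply: near_eq_cvg.
have fgs : f s = g s by exact: (nbhs_singleton fg).
near=> u; rewrite /diff_quot fgs; congr ((_ - _) / _).
by near: u; exact: near_dnbhs_in.
Unshelve. all: by end_near. Qed.

Lemma has_derive_in_continuous f s l :
  has_derive_in f s l -> f u @[u --> within I (nbhs s)] --> f s.
Proof.
move=> fl.
have fc : f u @[u --> within I s^'] --> f s.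
  have -> : f s = l * (s - s) + f s by rewrite subrr mulr0 add0r.
  apply: (@cvg_trans _ ((diff_quot f s u * (u - s) + f s) @[u --> within I s^'])).
    apply: near_eq_cvg; near=> u; rewrite /diff_quot divfK ?subrK//.
    by rewrite subr_eq0; near: u; exact: neq_dnbhs_in.
  apply: cvgD; last exact: cvg_cst.
  apply: cvgM fl _; apply: cvgB; last exact: cvg_cst.
  by apply: cvg_within_filter; apply: cvg_within.
move=> A fsA; have : \forall u \near within I s^', A (f u) by exact: fc.
rewrite near_withinE near_withinE => h; change (\forall u \near within I (nbhs s), A (f u)).
rewrite near_withinE; apply: filterS h => u /=.
have [->|us] := eqVneq u s; first by move=> _ _; exact: nbhs_singleton.
by move=> h Iu; exact: (h isT).
Unshelve. all: by end_near. Qed.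

Lemma has_derive_in_cst c s : has_derive_in (fun=> c) s 0.
Proof.
apply: (@cvg_trans _ (0 @[u --> within I s^'])); last exact: cvg_cst.
by apply: near_eq_cvg; apply: nearW => u; rewrite /diff_quot subrr mul0r.
Qed.

Lemma has_derive_in_id s : has_derive_in id s 1.
Proof.
apply: (@cvg_trans _ (1 @[u --> within I s^'])); last exact: cvg_cst.
apply: near_eq_cvg; near=> u; rewrite /diff_quot divff// subr_eq0.
by near: u; exact: neq_dnbhs_in.
Unshelve. all: by end_near. Qed.

Lemma has_derive_inD f g s l l' : has_derive_in f s l -> has_derive_in g s l' ->
  has_derive_in (fun u => f u + g u) s (l + l').
Proof.
move=> fl gl; apply: (cvg_trans _ (cvgD fl gl)); apply: near_eq_cvg.
by apply: nearW => u; rewrite fctE /diff_quot; ring.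
Qed.

Lemma has_derive_inM f g s l l' : has_derive_in f s l -> has_derive_in g s l' ->
  has_derive_in (fun u => f u * g u) s (l * g s + f s * l').
Proof.
move=> fl gl.
have gc : g u @[u --> within I s^'] --> g s.
  by move=> A /(has_derive_in_continuous gl)/near_dnbhs_in.
have H : (diff_quot f s u * g u + f s * diff_quot g s u) @[u --> within I s^']
    --> l * g s + f s * l'.
  by apply: cvgD; [exact: cvgM|exact: cvgMl_tmp].
apply: (cvg_trans _ H); apply: near_eq_cvg.
by apply: nearW => u; rewrite /diff_quot; ring.
Qed.

Lemma has_derive_inZ c f s l : has_derive_in f s l ->
  has_derive_in (fun u => c * f u) s (c * l).
Proof.
by move=> fl; have := has_derive_inM (has_derive_in_cst c s) fl; rewrite mul0r add0r.
Qed.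

Lemma has_derive_in_sum (J : finType) (f : J -> R -> R) (l : J -> R) s :
  (forall j, has_derive_in (f j) s (l j)) ->
  has_derive_in (fun u => \sum_j f j u) s (\sum_j l j).
Proof.
move=> fl; apply: (cvg_trans _ (cvg_fsum (within_filter I (dnbhs_filter s)) fl)).
apply: near_eq_cvg; apply: nearW => u.
by rewrite /diff_quot -sumrB mulr_suml.
Qed.

Hypothesis I_interval : nondegenerate_interval I.

Lemma nondegenerate_dnbhs s : I s -> ProperFilter (within I s^').
Proof.
move=> Is; case: I_interval => Iitv [a [b [Ia Ib ab]]].
apply: Build_ProperFilter_ex => P [e/= e0 Pe].
have e20 : 0 < e / 2 by rewrite divr_gt0.
have ee : e / 2 < e by lra.
have [sb|bs] := ltP s b.
  pose v := Num.min b (s + e / 2).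
  have sv : s < v by rewrite lt_min sb/= ltrDl.
  have vb : v <= b by rewrite ge_min lexx.
  have vs : v <= s + e / 2 by rewrite ge_min lexx orbT.
  exists v; apply: Pe => /=.
  - by rewrite ltr0_norm; lra.
  - by rewrite gt_eqF.
  - by apply: (Iitv _ _ Is Ib); rewrite (ltW sv).
pose v := Num.max a (s - e / 2).
have sv : v < s by rewrite gt_max; apply/andP; split; lra.
have av : a <= v by rewrite le_max lexx.
have vs : s - e / 2 <= v by rewrite le_max lexx orbT.
exists v; apply: Pe => /=.
- by rewrite gtr0_norm; lra.
- by rewrite lt_eqF.
- by apply: (Iitv _ _ Ia Is); rewrite av (ltW sv).
Qed.

Lemma derive_inE f s l : I s -> has_derive_in f s l -> derive_in I f s = l.
Proof.
by move=> /nondegenerate_dnbhs PF; apply: cvg_lim; exact: Rhausdorff.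
Qed.

Lemma has_derive_in_derivable f s l : has_derive_in f s l -> derivable_in I f s.
Proof. by move=> fl; apply/cvg_ex; exists l. Qed.

Lemma derivable_in_has f s : derivable_in I f s ->
  has_derive_in f s (derive_in I f s).
Proof. by []. Qed.

Lemma near_dnbhs_shift s (P : set R) :
  (\forall u \near s^', P u) <-> (\forall h \near 0^', P (h + s)).
Proof.
rewrite !near_withinE; split=> -[e/= e0 Pe]; exists e => //= u.
  rewrite /= sub0r normrN => ue u0; apply: Pe => /=.
    by rewrite opprD addrCA subrr addr0 normrN.
  by rewrite -subr_eq0 addrK.
move=> se us; rewrite -(subrK s u); apply: Pe => /=; rewrite ?subr_eq0//.
by rewrite sub0r normrN distrC.
Qed.

(** At an interior point the relative derivative is the ordinary one, so that
    the library's mean value theorem becomes available. *)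
Lemma has_derive_inP f s l : nbhs s I ->
  has_derive_in f s l <-> is_derive s 1 f l.
Proof.
move=> nI.
have -> : has_derive_in f s l <-> diff_quot f s u @[u --> s^'] --> l.
  rewrite /has_derive_in; split => fl; last exact: cvg_within_filter.
  move=> A lA; have : \forall u \near within I s^', A (diff_quot f s u) by exact: fl.
  rewrite near_withinE near_withinE => h.
  change (\forall u \near s^', A (diff_quot f s u)); rewrite near_withinE.
  by apply: filterS2 h nI => u h Iu us; exact: h.
pose q h := h^-1 *: ((f \o shift s) (h *: 1) - f s).
have -> : diff_quot f s u @[u --> s^'] --> l <-> q h @[h --> 0^'] --> l.
  have E : (fun h => diff_quot f s (h + s)) = q.
    apply/funext => h.
    by rewrite /q /diff_quot /= addrK /GRing.scale/= mulr1 mulrC.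
  rewrite -E; split => fl A /fl.
    by move=> /near_dnbhs_shift.
  by move=> h; apply/near_dnbhs_shift.
split=> [fl|[fd <-]]; last exact: fd.
by split; [apply/cvg_ex; exists l|apply: cvg_lim].
Qed.

End DerivativeIn.

(** * Mean values and slopes in several variables *)

Section MeanValue.
Variables (R : realType) (n : nat).
Implicit Types (f : 'rV[R]_n -> R) (x z a : 'rV[R]_n) (i : 'I_n).

Lemma is_derive_line f x i t : derivable f (x + t *: delta_mx 0 i) (delta_mx 0 i) ->
  is_derive t 1 (fun t => f (x + t *: delta_mx 0 i))
    (partial i f (x + t *: delta_mx 0 i)).
Proof.
set e := delta_mx 0 i => fd; set g := fun t => f (x + t *: e).
have E : (fun h => h^-1 *: ((g \o shift t) (h *: 1) - g t)) =
    (fun h => h^-1 *: ((f \o shift (x + t *: e)) (h *: e) - f (x + t *: e))).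
  apply/funext => h; rewrite /g /=; congr (_ *: (f _ - _)).
  by rewrite [h *: 1]mulr1 scalerDl addrCA.
by apply: DeriveDef; rewrite /partial /derivable /derive E.
Qed.

(** The two conditions on [t] say that it lies between 0 and [d], for either
    sign of [d]. *)
Lemma line_mvt f x i d :
  (forall t, `|t| <= `|d| -> 0 <= t * d ->
     derivable f (x + t *: delta_mx 0 i) (delta_mx 0 i)) ->
  exists t, [/\ `|t| <= `|d|, 0 <= t * d &
    f (x + d *: delta_mx 0 i) - f x = d * partial i f (x + t *: delta_mx 0 i)].
Proof.
set e := delta_mx 0 i => fd; set g := fun t => f (x + t *: e).
have gd t : `|t| <= `|d| -> 0 <= t * d -> is_derive t 1 g (partial i f (x + t *: e)).
  by move=> t1 t2; apply: is_derive_line; exact: fd.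
have g0 : g 0 = f x by rewrite /g scale0r addr0.
have [d0|d0] := leP 0 d.
  have inb t : t \in `[0, d] -> `|t| <= `|d| /\ 0 <= t * d.
    by rewrite in_itv/= => /andP[t0 td]; rewrite !ger0_norm// mulr_ge0.
  have gi t : t \in `[0, d] -> is_derive t 1 g (partial i f (x + t *: e)).
    by move=> /inb[? ?]; exact: gd.
  have gc : {within `[0, d], continuous g}.
    by apply: derivable_within_continuous => t /gi[].
  have [c /inb[c1 c2] E] :=
    @MVT_segment R g _ 0 d d0 (fun t td => gi t (subset_itv_oo_cc td)) gc.
  exists c; split=> //.
  by rewrite -[LHS]/(g d - f x) -g0 E subr0 mulrC.
have inb t : t \in `[d, 0] -> `|t| <= `|d| /\ 0 <= t * d.
  rewrite in_itv/= => /andP[t0 td]; rewrite ler0_norm// (ltr0_norm d0).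
  by split; [rewrite lerN2|rewrite mulr_le0// ltW].
have gi t : t \in `[d, 0] -> is_derive t 1 g (partial i f (x + t *: e)).
  by move=> /inb[? ?]; exact: gd.
have gc : {within `[d, 0], continuous g}.
  by apply: derivable_within_continuous => t /gi[].
have [c /inb[c1 c2] E] :=
  @MVT_segment R g _ d 0 (ltW d0) (fun t td => gi t (subset_itv_oo_cc td)) gc.
exists c; split=> //.
by rewrite -[LHS]/(g d - f x) -g0 -opprB E sub0r mulrN opprK mulrC.
Qed.

Lemma mx_ballP a (r : R) x :
  ball a r x <-> 0 < r /\ forall j, `|a 0 j - x 0 j| < r.
Proof.
split=> -[r0 h]; split=> //; first by move=> j; exact: (h 0 j).
by move=> i j; rewrite (ord1 i); exact: h.
Qed.

(** Going from [x] to [z] by changing one coordinate at a time never leaves the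
    ball, because balls of row vectors are boxes. *)
Lemma partial_mvt f a r x z :
  (forall w i, ball a r w -> derivable f w (delta_mx 0 i)) ->
  ball a r x -> ball a r z ->
  exists xi : 'I_n -> 'rV[R]_n,
    [/\ forall i, ball a r (xi i),
        forall i j, `|xi i 0 j - x 0 j| <= `|z 0 j - x 0 j| &
        f z - f x = \sum_i (z 0 i - x 0 i) * partial i f (xi i)].
Proof.
move=> fd /mx_ballP[r0 ax] /mx_ballP[_ az].
(* the corners of that path: the first k coordinates have been changed *)
pose w k : 'rV[R]_n := \row_j (if (j < k)%N then z 0 j else x 0 j).
have [t tP] : {t : 'I_n -> R & forall i : 'I_n,
    [/\ `|t i| <= `|z 0 i - x 0 i|, 0 <= t i * (z 0 i - x 0 i) &
    f (w i.+1) - f (w i) = (z 0 i - x 0 i) * partial i f (w i + t i *: delta_mx 0 i)]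
    /\ ball a r (w i + t i *: delta_mx 0 i)}.
  have inball (i : 'I_n) t : `|t| <= `|z 0 i - x 0 i| -> 0 <= t * (z 0 i - x 0 i) ->
      ball a r (w i + t *: delta_mx 0 i).
    move=> t1 t2; apply/mx_ballP; split=> // j; rewrite !mxE eqxx /=.
    have [->|ji] := eqVneq j i; last first.
      by rewrite mulr0 addr0; case: ifP.
    rewrite ltnn mulr1; have := ax i; have := az i; move: t1 t2.
    set X := x 0 i; set Z := z 0 i; set A := a 0 i.
    rewrite !ltr_norml => t1 t2 /andP[? ?] /andP[? ?].
    have [xz|xz] := leP X Z.
      have t0 : 0 <= t.
        have [e|ne] := eqVneq Z X.
          by move: t1; rewrite e subrr normr0 normr_le0 => /eqP->.
        by rewrite -(pmulr_lge0 t (_ : 0 < Z - X))// subr_gt0 lt_neqAle eq_sym ne.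
      by move: t1; rewrite !ger0_norm ?subr_ge0// => t1; apply/andP; split; lra.
    have t0 : t <= 0 by rewrite -(nmulr_lge0 t (_ : Z - X < 0))// subr_lt0.
    move: t1; rewrite ler0_norm// ltr0_norm ?subr_lt0// => t1.
    by apply/andP; split; lra.
  apply: (@choice _ _ (fun (i : 'I_n) t => [/\ `|t| <= `|z 0 i - x 0 i|, 0 <= t * (z 0 i - x 0 i) &
    f (w i.+1) - f (w i) = (z 0 i - x 0 i) * partial i f (w i + t *: delta_mx 0 i)]
    /\ ball a r (w i + t *: delta_mx 0 i))) => i.
  have [|t [t1 t2 E]] := @line_mvt f (w i) i (z 0 i - x 0 i).
    by move=> t t1 t2; apply: fd; exact: inball.
  exists t; split; last exact: inball.
  split=> //; rewrite -E; congr (f _ - _).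
  apply/rowP => j; rewrite !mxE eqxx/= ltnS leq_eqVlt -val_eqE/=.
  have [/val_inj->|ji] := eqVneq (val j) (val i).
    by rewrite ltnn /= mulr1 addrCA subrr addr0.
  by rewrite /= mulr0 addr0.
exists (fun i => w i + t i *: delta_mx 0 i); split=> [i|i j|].
- by have [] := tP i.
- have [[t1 _ _] _] := tP i; rewrite !mxE eqxx/=.
  have [->|ji] := eqVneq j i; first by rewrite ltnn mulr1 addrAC subrr add0r.
  by rewrite mulr0 addr0; case: ifP => //; rewrite subrr normr0.
transitivity (\sum_(i < n) (f (w i.+1) - f (w i))).
  rewrite -(big_mkord xpredT (fun k => f (w k.+1) - f (w k))) telescope_sumr//.
  congr (f _ - f _); apply/rowP => j; rewrite !mxE ?ltn_ord//.
by apply: eq_bigr => i _; have [[]] := tP i.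
Qed.

End MeanValue.

Section SmoothFunctions.
Variables (R : realType).

Lemma open_within_continuousP n (U : set 'rV[R]_n) (f : 'rV[R]_n -> R) : open U ->
  {within U, continuous f} <-> (forall x, U x -> {for x, continuous f}).
Proof.
move=> oU; split=> [/subspace_continuousP h x Ux|h].
  have := h x Ux; rewrite within_interior//; exact: (open_nbhs_nbhs (conj oU Ux)).
apply/subspace_continuousP => x Ux.
by rewrite within_interior; [exact: h|exact: (open_nbhs_nbhs (conj oU Ux))].
Qed.

Section Ck.
Variables (n : nat) (U : set 'rV[R]_n).
Hypothesis oU : open U.
Implicit Types (f g : 'rV[R]_n -> R) (k : nat) (x : 'rV[R]_n).

Let nU x : U x -> nbhs x U.
Proof. by move=> Ux; exact: open_nbhs_nbhs. Qed.

Lemma Ck_continuous k f x : Ck k U f -> U x -> {for x, continuous f}.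
Proof. by case: k => [|k] [/open_within_continuousP fc _]; exact: fc. Qed.

Lemma Ck_derivable k f x i : Ck k.+1 U f -> U x -> derivable f x (delta_mx 0 i).
Proof. by move=> [_ /(_ i)[+ _]]; exact. Qed.

Lemma Ck_partial k f i : Ck k.+1 U f -> Ck k U (partial i f).
Proof. by move=> [_ /(_ i)[]]. Qed.

Lemma CkW k f : Ck k.+1 U f -> Ck k U f.
Proof.
elim: k f => [|k ih] f [fc fd]; split=> // i.
by have [? /ih] := fd i; split.
Qed.

(** Every point of the open set [U] has a neighbourhood on which the functions
    agree, and partial derivatives only see germs. *)
Lemma Ck_eq k f g : (forall x, U x -> f x = g x) -> Ck k U f -> Ck k U g.
Proof.
have near_fg f' g' x : (forall x, U x -> f' x = g' x) -> U x -> {near x, f' =1 g'}.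
  by move=> fg Ux; apply: filterS (nU Ux).
have contU f' g' : (forall x, U x -> f' x = g' x) ->
    {within U, continuous f'} -> {within U, continuous g'}.
  move=> fg /(open_within_continuousP _ oU) fc.
  apply/(open_within_continuousP _ oU) => x Ux; have gx : g' x = f' x by rewrite fg.
  rewrite /prop_for /continuous_at gx; apply: (cvg_trans _ (fc x Ux)).
  by apply: (@near_eq_cvg _ _ (nbhs x)); exact: near_fg.
elim: k f g => [|k ih] f g fg [fc fd]; first by split=> //; exact: contU fc.
split; first exact: contU fc.
move=> i; have [df pf] := fd i; split => [x Ux|].
  exact: near_eq_derivable (near_fg _ _ _ fg Ux) (df x Ux).
by apply: ih pf => x Ux; apply: near_eq_derive; exact: near_fg.
Qed.

(** Partial derivatives are derivatives along lines, which turns the rules of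
    the one-variable calculus into rules for partial derivatives. *)
Lemma has_derive_line f x i l :
  has_derive_in setT (fun t => f (x + t *: delta_mx 0 i)) 0 l <->
  derivable f x (delta_mx 0 i) /\ partial i f x = l.
Proof.
rewrite has_derive_inP; last exact: filterT.
have E : (fun h => h^-1 *: (((fun t => f (x + t *: delta_mx 0 i)) \o shift 0) (h *: 1)
             - f (x + 0 *: delta_mx 0 i))) =
    (fun h => h^-1 *: ((f \o shift x) (h *: delta_mx 0 i) - f x)).
  apply/funext => h; rewrite /= scale0r !addr0; congr (_ *: (f _ - _)).
  by rewrite [h *: 1]mulr1 addrC.
split=> [[]|[fd fl]]; first by rewrite /derivable /derive E.
by apply: DeriveDef; rewrite /derivable /derive E.
Qed.

(** A function of class C^1 is differentiable, in Caratheodory's form: the slopes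
    [q z] are the partial derivatives at the intermediate points of
    [partial_mvt], which tend to [x] with [z].  The chain rule below follows
    without any estimate. *)
Lemma C1_slopes f x : Ck 1 U f -> U x ->
  exists q : 'rV[R]_n -> 'I_n -> R,
    (forall i, q z i @[z --> x] --> partial i f x) /\
    \forall z \near x, f z - f x = \sum_i (z 0 i - x 0 i) * q z i.
Proof.
move=> Uf Ux; have /nbhs_ballP[r r0 rU] := nU Ux.
have fd w i : ball x r w -> derivable f w (delta_mx 0 i).
  by move=> /rU Uw; exact: Ck_derivable Uf Uw.
have xx := ballxx x r0.
have /choice[xi xiP] : forall z, exists xi : 'I_n -> 'rV[R]_n, ball x r z ->
    (forall i j, `|xi i 0 j - x 0 j| <= `|z 0 j - x 0 j|) /\
        f z - f x = \sum_i (z 0 i - x 0 i) * partial i f (xi i).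
  move=> z.
  have [xz|nxz] := pselect (ball x r z); last by exists (fun=> 0).
  by have [xi [_ h1 h2]] := partial_mvt fd xx xz; exists xi.
exists (fun z i => partial i f (xi z i)); split; last first.
  by apply/nbhs_ballP; exists r => // z /xiP[].
move=> i; have fc : {for x, continuous (partial i f)}.
  exact: Ck_continuous (Ck_partial i Uf) Ux.
suff xic : xi z i @[z --> x] --> x by exact: (cvg_comp _ _ xic fc).
apply/(@cvg_ballP R _ _ (nbhs x) (nbhs_filter x) _ x) => e e0.
have e'0 : 0 < Num.min e r by rewrite lt_min e0.
near=> z.
have /mx_ballP[_ xz] : ball x (Num.min e r) z by near: z; exact: nbhsx_ballx.
have [|xi1 _] := xiP z.
  by apply/mx_ballP; split=> // j; apply: lt_le_trans (xz j) _; rewrite ge_min lexx orbT.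
apply/mx_ballP; split=> // j; rewrite distrC; apply: le_lt_trans (xi1 i j) _.
by rewrite distrC; apply: lt_le_trans (xz j) _; rewrite ge_min lexx.
Unshelve. all: by end_near. Qed.

Lemma has_derive_in_comp (I : set R) f (y : R -> 'rV[R]_n) (s : R) (v : 'rV[R]_n) :
  I s -> Ck 1 U f -> U (y s) ->
  (forall i, has_derive_in I (fun u => y u 0 i) s (v 0 i)) ->
  has_derive_in I (fun u => f (y u)) s (\sum_i v 0 i * partial i f (y s)).
Proof.
move=> Is Uf Uy yv; have [q [qc qE]] := C1_slopes Uf Uy.
have yc : y u @[u --> within I (nbhs s)] --> y s.
  apply: cvg_mx => i j; rewrite (ord1 i); exact: has_derive_in_continuous.
have yc' : y u @[u --> within I s^'] --> y s by move=> A /yc/near_dnbhs_in.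
have H : (\sum_i diff_quot (fun u => y u 0 i) s u * q (y u) i)
    @[u --> within I s^'] --> \sum_i v 0 i * partial i f (y s).
  apply: cvg_fsum => i; apply: cvgM (yv i) _.
  exact: (cvg_comp _ _ yc' (qc i)).
apply: cvg_trans H; apply: near_eq_cvg; near=> u.
rewrite /diff_quot.
have -> : f (y u) - f (y s) = \sum_i (y u 0 i - y s 0 i) * q (y u) i.
  by near: u; exact: (yc' _ qE).
by rewrite mulr_suml; apply: eq_bigr => i _; rewrite mulrAC.
Unshelve. all: by end_near. Qed.

End Ck.
End SmoothFunctions.

(** * Closure properties of the functions of class C^k *)

Section Closure.
Variables (R : realType) (n : nat) (U : set 'rV[R]_n).
Hypothesis oU : open U.
Implicit Types (f g : 'rV[R]_n -> R) (k : nat) (x : 'rV[R]_n).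

(** The induction step of all the lemmas below: it suffices to exhibit the
    partial derivatives and to know that they are of class C^k. *)
Lemma Ck_step k f (df : 'I_n -> 'rV[R]_n -> R) :
  {within U, continuous f} ->
  (forall x i, U x ->
    has_derive_in setT (fun t => f (x + t *: delta_mx 0 i)) 0 (df i x)) ->
  (forall i, Ck k U (df i)) -> Ck k.+1 U f.
Proof.
move=> fc fd dfk; split=> // i; split=> [x Ux|].
  by have /has_derive_line[] := fd x i Ux.
apply: (Ck_eq oU) (dfk i) => x Ux.
by have /has_derive_line[] := fd x i Ux.
Qed.

Lemma Ck_line k f x i : Ck k.+1 U f -> U x ->
  has_derive_in setT (fun t => f (x + t *: delta_mx 0 i)) 0 (partial i f x).
Proof. by move=> fk Ux; apply/has_derive_line; split=> //; exact: Ck_derivable fk Ux. Qed.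

Lemma Ck_cst k (c : R) : Ck k U (fun=> c).
Proof.
elim: k c => [|k ih] c.
  by split=> //; apply/(open_within_continuousP _ oU) => x _; exact: (@cst_continuous _ _ c x).
apply: (@Ck_step _ _ (fun _ _ => 0)) => [|x i _|i].
- by apply/(open_within_continuousP _ oU) => x _; exact: (@cst_continuous _ _ c x).
- exact: has_derive_in_cst.
- exact: ih.
Qed.

Lemma Ck_coord k (j : 'I_n) : Ck k U (fun x => x 0 j).
Proof.
have c : {within U, continuous (fun x : 'rV[R]_n => x 0 j)}.
  apply/(open_within_continuousP _ oU) => x _.
  exact: matrix_normedtype.coord_continuous.
case: k => [|k]; first by split.
apply: (@Ck_step _ _ (fun i _ => (j == i)%:R)) => // [x i _|i]; last exact: Ck_cst.
under [X in has_derive_in _ X]eq_fun do rewrite !mxE eqxx/=.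
have := has_derive_inD (has_derive_in_cst setT (x 0 j) 0)
  (has_derive_inM (has_derive_in_id setT 0) (has_derive_in_cst setT (j == i)%:R 0)).
by rewrite mulr0 mul1r addr0 add0r.
Qed.

Lemma CkD k f g : Ck k U f -> Ck k U g -> Ck k U (fun x => f x + g x).
Proof.
elim: k f g => [|k ih] f g fk gk.
  split=> //; apply/(open_within_continuousP _ oU) => x Ux.
  exact: (cvgD (Ck_continuous oU fk Ux) (Ck_continuous oU gk Ux)).
apply: (@Ck_step _ _ (fun i x => partial i f x + partial i g x)) => [|x i Ux|i].
- apply/(open_within_continuousP _ oU) => x Ux.
  exact: (cvgD (Ck_continuous oU fk Ux) (Ck_continuous oU gk Ux)).
- by apply: has_derive_inD; apply: Ck_line; eauto.
- by apply: ih; exact: Ck_partial.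
Qed.

Lemma CkM k f g : Ck k U f -> Ck k U g -> Ck k U (fun x => f x * g x).
Proof.
elim: k f g => [|k ih] f g fk gk.
  split=> //; apply/(open_within_continuousP _ oU) => x Ux.
  exact: (cvgM (Ck_continuous oU fk Ux) (Ck_continuous oU gk Ux)).
apply: (@Ck_step _ _ (fun i x => partial i f x * g x + f x * partial i g x)) => [|x i Ux|i].
- apply/(open_within_continuousP _ oU) => x Ux.
  exact: (cvgM (Ck_continuous oU fk Ux) (Ck_continuous oU gk Ux)).
- have -> : partial i f x * g x + f x * partial i g x =
    partial i f x * g (x + 0 *: delta_mx 0 i) + f (x + 0 *: delta_mx 0 i) * partial i g x.
    by rewrite scale0r addr0.
  by apply: (@has_derive_inM _ _ (fun t => f (x + t *: delta_mx 0 i))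
      (fun t => g (x + t *: delta_mx 0 i))); apply: Ck_line; eauto.
- by apply: CkD; apply: ih; (exact: Ck_partial || exact: CkW).
Qed.

Lemma Ck_sum k (J : finType) (f : J -> 'rV[R]_n -> R) :
  (forall j, Ck k U (f j)) -> Ck k U (fun x => \sum_j f j x).
Proof.
move=> fk; elim: (index_enum J) => [|j r ih].
  by under eq_fun do rewrite big_nil; exact: Ck_cst.
by under eq_fun do rewrite big_cons; exact: CkD.
Qed.

Lemma Ck_prod k (J : finType) (f : J -> 'rV[R]_n -> R) :
  (forall j, Ck k U (f j)) -> Ck k U (fun x => \prod_j f j x).
Proof.
move=> fk; elim: (index_enum J) => [|j r ih].
  by under eq_fun do rewrite big_nil; exact: Ck_cst.
by under eq_fun do rewrite big_cons; exact: CkM.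
Qed.

Lemma Ck_inv k f : (forall x, U x -> f x != 0) -> Ck k U f -> Ck k U (fun x => (f x)^-1).
Proof.
move=> f0; elim: k => [|k ih] fk.
  split=> //; apply/(open_within_continuousP _ oU) => x Ux.
  exact: (cvgV (f0 x Ux) (Ck_continuous oU fk Ux)).
apply: (@Ck_step _ _ (fun i x =>
  - 1 * (partial i f x * ((f x)^-1 * (f x)^-1)))) => [|x i Ux|i].
- apply/(open_within_continuousP _ oU) => x Ux.
  exact: (cvgV (f0 x Ux) (Ck_continuous oU fk Ux)).
- have [fd _] := (has_derive_line f x i (partial i f x)).1 (Ck_line fk Ux).
  apply/(has_derive_line (fun x => (f x)^-1)); split.
    by apply: derivableV => //; exact: f0.
  rewrite /partial deriveV//; last exact: f0.
  by rewrite /GRing.scale/= expr2 invfM; ring.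
- apply: CkM; first exact: Ck_cst.
  apply: CkM; first exact: Ck_partial.
  by apply: CkM; apply: ih; exact: CkW.
Qed.

Lemma Ck_comp k p (V : set 'rV[R]_p) (phi : 'rV[R]_n -> 'rV[R]_p)
    (F : 'rV[R]_p -> R) : open V -> (forall x, U x -> V (phi x)) ->
  (forall j, Ck k U (fun x => phi x 0 j)) -> Ck k V F ->
  Ck k U (fun x => F (phi x)).
Proof.
move=> oV UV.
have comp_continuous k' G : (forall j, Ck k' U (fun x => phi x 0 j)) ->
    Ck k' V G -> {within U, continuous (fun x => G (phi x))}.
  move=> phik Gk; apply/(open_within_continuousP _ oU) => x Ux.
  have c : phi u @[u --> x] --> phi x.
    apply: (@cvg_mx _ _ _ (nbhs_filter x)) => i j; rewrite (ord1 i).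
    exact: (Ck_continuous oU (phik j) Ux).
  exact: (cvg_comp _ _ c (Ck_continuous oV Gk (UV _ Ux))).
elim: k F => [|k ih] F phik Fk; have c := comp_continuous _ _ phik Fk.
  by split.
apply: (@Ck_step _ _ (fun i x =>
   \sum_j partial i (fun x => phi x 0 j) x * partial j F (phi x))) => // [x i Ux|i].
  have F1 : Ck 1 V F by elim: (k) Fk => // k' ih' /CkW.
  have := @has_derive_in_comp _ _ V oV setT F
    (fun t => phi (x + t *: delta_mx 0 i)) 0
    (\row_j partial i (fun x => phi x 0 j) x) I F1.
  rewrite scale0r addr0 => /(_ (UV _ Ux)) H.
  pose w := \row_j partial i (fun x => phi x 0 j) x.
  have -> : \sum_j partial i (fun x => phi x 0 j) x * partial j F (phi x) =
      \sum_j w 0 j * partial j F (phi x) by apply: eq_bigr => j _; rewrite mxE.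
  apply: H => j; rewrite mxE.
  exact: (@Ck_line k (fun x => phi x 0 j)).
apply: Ck_sum => j; apply: CkM; first exact: Ck_partial.
by apply: ih; [move=> ?; exact: CkW|exact: Ck_partial].
Qed.

End Closure.

(** * Symmetry of second derivatives *)

Section SecondOrder.
Variables (R : realType) (n : nat) (U : set 'rV[R]_n).
Hypothesis oU : open U.

Let second_difference (f : 'rV[R]_n -> R) (x : 'rV[R]_n) (i j : 'I_n) (h : R) :=
  f (x + h *: delta_mx 0 i + h *: delta_mx 0 j) - f (x + h *: delta_mx 0 i)
  - (f (x + h *: delta_mx 0 j) - f x).

Lemma ball_delta2 (x : 'rV[R]_n) (i j : 'I_n) (r s t : R) :
  0 < r -> `|s| < r / 2 -> `|t| < r / 2 ->
  ball x r (x + s *: delta_mx 0 i + t *: delta_mx 0 j).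
Proof.
move=> r0 sr tr; apply/mx_ballP; split=> // k; rewrite !mxE eqxx/=.
rewrite -addrA opprD addrA subrr sub0r normrN.
apply: le_lt_trans (ler_normD _ _) _.
have H (c : R) (b : bool) : `|c| < r / 2 -> `|c * b%:R| < r / 2.
  by case: b; rewrite ?mulr1// mulr0 normr0 divr_gt0.
by have := H _ (k == i) sr; have := H _ (k == j) tr; lra.
Qed.

(** Two applications of the mean value theorem, first in the direction of
    [i] to the increment of [f] in the direction of [j], then in the direction
    of [j]. *)
Lemma second_mvt f x (i j : 'I_n) r h : Ck 2 U f -> 0 < r -> ball x r `<=` U ->
  0 < h -> h < r / 2 ->
  exists s t, [/\ `|s| <= h, `|t| <= h & second_difference f x i j h =
    h * h * partial j (partial i f) (x + s *: delta_mx 0 i + t *: delta_mx 0 j)].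
Proof.
move=> f2 r0 rU h0 hr; set ei := delta_mx 0 i; set ej := delta_mx 0 j.
have inU s t : `|s| <= h -> `|t| <= h -> U (x + s *: ei + t *: ej).
  by move=> sh th; apply: rU; apply: ball_delta2 => //; lra.
pose g y := f (y + h *: ej) - f y.
have hh : `|h| <= h by rewrite gtr0_norm.
have gd s : `|s| <= h -> derivable g (x + s *: ei) ei /\
    partial i g (x + s *: ei) =
    partial i f (x + s *: ei + h *: ej) - partial i f (x + s *: ei).
  move=> sh; apply/has_derive_line.
  apply: has_derive_inD.
    have := @Ck_line _ _ _ _ _ _ i f2 (inU _ _ sh hh).
    by under [X in has_derive_in _ X]eq_fun do rewrite addrAC.
  rewrite -mulN1r; under [X in has_derive_in _ X]eq_fun do rewrite -mulN1r.
  apply: has_derive_inZ; apply: Ck_line f2 _.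
  by have := inU s 0 sh; rewrite scale0r addr0 normr0; apply; exact: ltW.
have [s [sh _ E]] : exists s, [/\ `|s| <= `|h|, 0 <= s * h &
    g (x + h *: ei) - g x = h * partial i g (x + s *: ei)].
  by apply: line_mvt => s; rewrite (gtr0_norm h0) => sh _; have [] := gd _ sh.
rewrite (gtr0_norm h0) in sh.
have [t [th _ E']] : exists t, [/\ `|t| <= `|h|, 0 <= t * h &
    partial i f (x + s *: ei + h *: ej) - partial i f (x + s *: ei) =
    h * partial j (partial i f) (x + s *: ei + t *: ej)].
  apply: line_mvt => t; rewrite (gtr0_norm h0) => th _.
  by apply: Ck_derivable (Ck_partial i f2) _; exact: inU.
rewrite (gtr0_norm h0) in th.
by exists s, t; split=> //; rewrite -[LHS]/(g (x + h *: ei) - g x) E (gd _ sh).2 E' mulrA.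
Qed.

(** The second difference is symmetric in the two directions, so the two mixed
    derivatives take a common value, at points as close to [x] as one likes;
    both are continuous at [x]. *)
Lemma partialC f x (i j : 'I_n) : Ck 2 U f -> U x ->
  partial i (partial j f) x = partial j (partial i f) x.
Proof.
move=> f2 Ux; apply/eqP; rewrite -subr_eq0 -normr_le0.
apply/ler_addgt0Pr => e e0; rewrite add0r.
have cont a b := Ck_continuous oU (Ck_partial a (Ck_partial b f2)) Ux.
have e20 : 0 < e / 2 by rewrite divr_gt0.
have near_val a b : \forall z \near x,
    `|partial a (partial b f) x - partial a (partial b f) z| < e / 2.
  exact: (@cvgr_dist_lt _ _ _ _ (nbhs_filter x) _ _ (cont a b)).
have : \forall z \near x, [/\ U z,
    `|partial i (partial j f) x - partial i (partial j f) z| < e / 2 &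
    `|partial j (partial i f) x - partial j (partial i f) z| < e / 2].
  have := near_val i j; have := near_val j i.
  have : \forall z \near x, U z by exact: open_nbhs_nbhs.
  by apply: filterS3 => z ? ? ?; split.
move=> /nbhs_ballP[r r0 rP].
have r40 : 0 < r / 4 by rewrite divr_gt0.
have r42 : r / 4 < r / 2 by rewrite ltr_pM2l// ltf_pV2 ?posrE ?ltr_nat.
have rU : ball x r `<=` U by move=> z /rP[].
have [s [t [sr tr E]]] := second_mvt i j f2 r0 rU r40 r42.
have [s' [t' [sr' tr' E']]] := second_mvt j i f2 r0 rU r40 r42.
have sym : second_difference f x i j (r / 4) = second_difference f x j i (r / 4).
  rewrite /second_difference [x + _ *: delta_mx 0 j + _]addrAC; ring.
have : partial j (partial i f) (x + s *: delta_mx 0 i + t *: delta_mx 0 j) =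
    partial i (partial j f) (x + s' *: delta_mx 0 j + t' *: delta_mx 0 i).
  apply: (@mulfI _ (r / 4 * (r / 4))); first by rewrite mulf_neq0// gt_eqF.
  exact: etrans (esym E) (etrans sym E').
have [_ _ h1] := rP _ (ball_delta2 x i j r0 (le_lt_trans sr r42) (le_lt_trans tr r42)).
have [_ h2 _] := rP _ (ball_delta2 x j i r0 (le_lt_trans sr' r42) (le_lt_trans tr' r42)).
move=> Eq; rewrite Eq in h1; move: h1 h2.
set A := partial i _ x; set B := partial j _ x; set C := partial i _ _.
clearbody A B C; clear; rewrite !ltr_norml ler_norml => /andP[? ?] /andP[? ?].
by apply/andP; split; lra.
Qed.

End SecondOrder.

(** * Ordinary differential equations: existence *)

Section RealPreliminaries.
Variable R : realType.

(** The supremum of the lower bounds [a k - e k] is below all the upper bounds;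
    this yields a limit together with its rate of convergence. *)
Lemma nested_limit (a e : nat -> R) : (forall k j, a k - e k <= a j + e j) ->
  exists l, forall k, `|a k - l| <= e k.
Proof.
move=> ae; pose S := [set a k - e k | k in [set: nat]].
have S0 : S !=set0 by exists (a 0%N - e 0%N), 0%N.
have ubS j : ubound S (a j + e j) by move=> _ [k _ <-].
exists (sup S) => k; rewrite ler_distl; apply/andP; split.
  by rewrite lerBlDr; exact: ge_sup.
by rewrite -lerBlDr; apply: ub_le_sup; [exists (a 0%N + e 0%N) | exists k].
Qed.

Lemma le_geometric (x c E : R) : 0 <= E -> (forall k, x <= c + E / 2 ^+ k) -> x <= c.
Proof.
move=> E0 xc; apply/ler_addgt0Pr => e e0.
pose N := Num.bound (E / e).
have EN : E / e < N%:R by apply: Num.Theory.archi_boundP; rewrite divr_ge0// ltW.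
apply: le_trans (xc N) _; rewrite lerD2l ler_pdivrMr ?exprn_gt0// mulrC -ler_pdivrMr//.
by apply: (le_trans (ltW EN)); rewrite -natrX ler_nat ltnW// ltn_expl.
Qed.

(** The projection onto the interval of centre [a] and radius [r].  Composing
    with it makes a local vector field global, and a function on an interval
    continuous on the whole line. *)
Definition clip (a r x : R) := Num.max (a - r) (Num.min (a + r) x).

Lemma clip_lipschitz a r x y : 0 <= r -> `|clip a r x - clip a r y| <= `|x - y|.
Proof.
move=> r0; rewrite /clip.
have H u v : u <= v ->
  Num.max (a - r) (Num.min (a + r) u) <= Num.max (a - r) (Num.min (a + r) v) /\
  Num.max (a - r) (Num.min (a + r) v) - Num.max (a - r) (Num.min (a + r) u) <= v - u.
  move=> uv.
  rewrite !maxEle !minEle.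
  by case: (leP (a + r) u) => h1; case: (leP (a + r) v) => h2;
    case: (leP (a - r) (a + r)) => h3; case: (leP (a - r) u) => h4;
    case: (leP (a - r) v) => h5; split; lra.
have [xy|yx] := leP x y.
  by have [h1 h2] := H _ _ xy; rewrite distrC (distrC x) !ger0_norm ?subr_ge0.
by have [h1 h2] := H _ _ (ltW yx); rewrite !ger0_norm ?subr_ge0// ltW.
Qed.

Lemma clip_in a r x : 0 <= r -> `|clip a r x - a| <= r.
Proof.
move=> r0; rewrite /clip ler_distl !maxEle !minEle.
by case: (leP (a + r) x) => h1; case: (leP (a - r) (a + r)) => h2;
  case: (leP (a - r) x) => h3; apply/andP; split; lra.
Qed.

Lemma clip_id a r x : `|x - a| <= r -> clip a r x = x.
Proof.
rewrite ler_distl /clip !maxEle !minEle => /andP[h1 h2].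
by case: (leP (a + r) x) => h3; case: (leP (a - r) (a + r)) => h4;
  case: (leP (a - r) x) => h5; lra.
Qed.

Lemma antiderivative (f : R -> R) (c a : R) : 0 < a -> continuous f ->
  exists P : R -> R, P 0 = c /\ forall t : R, `|t| < a -> is_derive t 1 P (f t).
Proof.
move=> a0 fc; pose F x := (\int[lebesgue_measure]_(t in `[- a, x]) f t)%R.
have fi : lebesgue_measure.-integrable `[- a, a] (EFin \o f).
  apply: continuous_compact_integrable; first exact: segment_compact.
  exact: continuous_subspaceT.
exists (fun x => F x + (c - F 0)); split; first by rewrite addrC subrK.
move=> t; rewrite ltr_norml => /andP[ta at'].
have [Fd FE] := continuous_FTC1_closed at' fi ta (fc t).
have : is_derive t 1 F (f t) by apply: DeriveDef => //; rewrite -derive1E.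
by move=> H; have := is_deriveD H (is_derive_cst (c - F 0) t 1); rewrite addr0.
Qed.

Lemma mx_norm_leP n (x : 'rV[R]_n) B : 0 <= B ->
  `|x| <= B <-> forall j, `|x 0 j| <= B.
Proof.
move=> B0; rewrite [`|x|]mx_normrE; split=> [/bigmax_leP[_ h] j|h].
  exact: (h (0, j)).
by apply/bigmax_leP; split=> // -[i j] _ /=; rewrite (ord1 i).
Qed.

Lemma mx_norm_ge n (x : 'rV[R]_n) j : `|x 0 j| <= `|x|.
Proof. exact: mx_entry_le_norm. Qed.

Lemma derive_bound (f df : R -> R) (d B s t : R) :
  (forall u : R, `|u| <= d -> is_derive u 1 f (df u)) ->
  (forall u, `|u| <= d -> `|df u| <= B) ->
  `|s| <= d -> `|t| <= d -> `|f t - f s| <= B * `|t - s|.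
Proof.
move=> fd dB; wlog st : s t / s <= t.
  move=> H sd td; have [st|ts] := leP s t; first exact: H.
  by rewrite distrC (distrC t); apply: H => //; exact: ltW.
move=> sd0 td0; have [sd td] : - d <= s /\ t <= d.
  by move: sd0 td0; rewrite !ler_norml => /andP[? _] /andP[_ ?].
have inb u : u \in `[s, t] -> `|u| <= d.
  rewrite in_itv/= => /andP[su ut]; rewrite ler_norml.
  by rewrite (le_trans sd su) (le_trans ut td).
have fi u : u \in `[s, t] -> is_derive u 1 f (df u) by move=> /inb; exact: fd.
have fc : {within `[s, t], continuous f}.
  by apply: derivable_within_continuous => u /fi[].
have [c /inb cd ->] := @MVT_segment R f _ s t st (fun u us => fi u (subset_itv_oo_cc us)) fc.
by rewrite normrM ler_wpM2r// dB.
Qed.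

End RealPreliminaries.

Lemma lipschitz_real_continuous (R : realType) (f : R -> R) (K : R) :
  (forall u w, `|f u - f w| <= K * `|u - w|) -> continuous f.
Proof.
move=> fK x; apply/(@cvgrPdist_lt _ _ _ (nbhs x) (nbhs_filter x)) => e e0.
have K1 : 0 < `|K| + 1 by rewrite ltr_wpDl.
near=> u; apply: le_lt_trans (fK x u) _.
have xu : `|x - u| < e / (`|K| + 1).
  near: u; apply: (@cvgr_dist_lt _ _ _ _ (nbhs_filter x) id x) => //.
  by rewrite divr_gt0.
apply: (@le_lt_trans _ _ ((`|K| + 1) * `|x - u|)).
  by rewrite ler_wpM2r// (le_trans (ler_norm K))// lerDl.
by rewrite mulrC -ltr_pdivlMr.
Unshelve. all: by end_near. Qed.

Section PicardLipschitz.
Variables (R : realType) (n : nat) (H : 'rV[R]_n -> 'rV[R]_n) (L C d : R).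
Variable y0 : 'rV[R]_n.
Hypotheses (L0 : 0 <= L) (C0 : 0 <= C) (d0 : 0 < d) (Ld : L * d <= 2^-1).
Hypothesis lipH : forall z w, `|H z - H w| <= L * `|z - w|.
Hypothesis bdH : forall z, `|H z| <= C.

(* The invariant of the iteration, and one step of it in differential form:
   [Y] is y0 plus the integral from 0 of H along [y]. *)
Let lip (y : R -> 'rV[R]_n) :=
  forall s t, `|s| <= d -> `|t| <= d -> `|y t - y s| <= C * `|t - s|.

Let step (y Y : R -> 'rV[R]_n) := Y 0 = y0 /\ forall t : R, `|t| <= d ->
  forall i, is_derive t 1 (fun u => Y u 0 i) (H (y t) 0 i).

Let exists_step y : lip y -> exists Y, step y Y.
Proof.
move=> ly; pose h u := H (y (clip 0 d u)).
have hc i : continuous (fun u => h u 0 i).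
  apply: (@lipschitz_real_continuous _ _ (L * C)) => u w.
  apply: (@le_trans _ _ `|h u - h w|).
    by have := mx_norm_ge (h u - h w) i; rewrite !mxE.
  apply: le_trans (lipH _ _) _; rewrite -mulrA ler_wpM2l//.
  have cd v : `|clip 0 d v| <= d by rewrite -[clip _ _ _]subr0 clip_in// ltW.
  apply: le_trans (ly _ _ (cd w) (cd u)) _.
  by rewrite ler_wpM2l// clip_lipschitz// ltW.
have d2 : 0 < 2 * d by rewrite mulr_gt0.
have /choice[P PP] i := antiderivative (y0 0 i) d2 (hc i).
exists (fun u => \row_i P i u); split.
  by apply/rowP => i; rewrite mxE (PP i).1.
move=> t td i; under [X in is_derive _ _ X]eq_fun do rewrite mxE.
have -> : H (y t) = h t by rewrite /h clip_id// subr0.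
by apply: (PP i).2; apply: (le_lt_trans td); rewrite ltr_pMl// ltr1n.
Qed.

Let step_lip y Y : step y Y -> lip Y.
Proof.
move=> [_ Yd] s t sd td; apply/mx_norm_leP; first by rewrite mulr_ge0.
move=> i; have -> : (Y t - Y s) 0 i = Y t 0 i - Y s 0 i by rewrite !mxE.
apply: (@derive_bound _ (fun u => Y u 0 i) (fun u => H (y u) 0 i) d C s t) => //.
  by move=> u ud; exact: Yd.
by move=> u _; apply: le_trans (bdH (y u)); exact: mx_norm_ge.
Qed.

(* The step halves distances on [-d, d], since L d <= 1/2. *)
Let step_contract y z Y Z B : step y Y -> step z Z -> 0 <= B ->
  (forall t, `|t| <= d -> `|y t - z t| <= B) ->
  forall t, `|t| <= d -> `|Y t - Z t| <= B / 2.
Proof.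
move=> [Y0 Yd] [Z0 Zd] B0 yz t td.
have [B20 LB0] : 0 <= B / 2 /\ 0 <= L * B by rewrite divr_ge0// mulr_ge0.
apply/mx_norm_leP => // i.
pose D u := Y u 0 i - Z u 0 i.
have DE : D t - D 0 = (Y t - Z t) 0 i.
  by rewrite /D Y0 Z0 subrr subr0 !mxE.
rewrite -DE; have : `|D t - D 0| <= L * B * `|t - 0|.
  apply: (@derive_bound _ D (fun u => H (y u) 0 i - H (z u) 0 i) d) => //.
  - by move=> u ud; exact: is_deriveB (Yd u ud i) (Zd u ud i).
  - move=> u ud; apply: (@le_trans _ _ `|H (y u) - H (z u)|).
      by have := mx_norm_ge (H (y u) - H (z u)) i; rewrite !mxE.
    by apply: le_trans (lipH _ _) _; rewrite ler_wpM2l// yz.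
  - by rewrite normr0 ltW.
rewrite subr0 => h; apply: le_trans h _.
apply: (@le_trans _ _ (L * B * d)); first by rewrite ler_wpM2l.
by rewrite mulrAC mulrC ler_wpM2l.
Qed.

(** The iterates of [step] converge geometrically, uniformly on [-d, d]; the
    limit has Lipschitz constant [C], so [step] applies to it, and it is fixed
    by [step] by contraction. *)
Lemma picard_lipschitz : exists Y : R -> 'rV[R]_n, Y 0 = y0 /\
  forall t : R, `|t| <= d -> forall i, is_derive t 1 (fun u => Y u 0 i) (H (Y t) 0 i).
Proof.
have /choice[Phi PhiP] y : exists Y, lip y -> step y Y.
  have [ly|nly] := pselect (lip y); last by exists y.
  by have [Y] := exists_step ly; exists Y.
pose yk k := iter k Phi (fun=> y0).
have lip0 : lip (fun=> y0) by move=> s t _ _; rewrite subrr normr0 mulr_ge0.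
have lipk k : lip (yk k).
  by elim: k => // k ih; exact: step_lip (PhiP _ ih).
have stepk k : step (yk k) (yk k.+1) by exact: PhiP.
pose B := C * d.
have B0 : 0 <= B by rewrite mulr_ge0// ltW.
have dk k t : `|t| <= d -> `|yk k.+1 t - yk k t| <= B / 2 ^+ k.
  elim: k t => [|k ih] t td.
    have [E _] := stepk 0%N; rewrite expr0 divr1.
    rewrite -[yk 0%N t]/y0 -E.
    have d00 : `|0 : R| <= d by rewrite normr0 ltW.
    apply: le_trans (lipk 1%N 0 t d00 td) _; rewrite subr0.
    by rewrite ler_wpM2l.
  rewrite exprSr invfM mulrA.
  apply: (step_contract (stepk k.+1) (stepk k)) => //.
  by rewrite divr_ge0// exprn_ge0.
have half k : B / 2 ^+ k = 2 * (B / 2 ^+ k.+1).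
  by rewrite exprS; field; rewrite expf_neq0.
have dkp k p t : `|t| <= d ->
    `|yk (k + p)%N t - yk k t| <= 2 * (B / 2 ^+ k) - 2 * (B / 2 ^+ (k + p)).
  move=> td; elim: p => [|p ih]; first by rewrite addn0 !subrr normr0.
  rewrite addnS; have := dk (k + p)%N t td; have := half (k + p)%N.
  have := ler_distD (yk (k + p)%N t) (yk (k + p).+1 t) (yk k t).
  move: ih; lra.
have pw t : exists l : 'rV[R]_n, `|t| <= d -> forall k, `|yk k t - l| <= 2 * (B / 2 ^+ k).
  have [td|ntd] := pselect (`|t| <= d); last by exists 0.
  have pos k : 0 <= 2 * (B / 2 ^+ k) by rewrite mulr_ge0// divr_ge0// exprn_ge0.
  have /choice[l lP] : forall i : 'I_n, exists l,
      forall k, `|yk k t 0 i - l| <= 2 * (B / 2 ^+ k).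
    move=> i; apply: nested_limit => k j.
    have ji a b : (a <= b)%N ->
        `|yk b t 0 i - yk a t 0 i| <= 2 * (B / 2 ^+ a) - 2 * (B / 2 ^+ b).
      move=> /subnKC <-; apply: le_trans (dkp _ _ _ td).
      by have := mx_norm_ge (yk (a + (b - a))%N t - yk a t) i; rewrite !mxE.
    have := pos k; have := pos j; have [kj|jk] := leqP k j.
      have := ji _ _ kj; rewrite ler_norml => /andP[]; lra.
    have := ji _ _ (ltnW jk); rewrite ler_norml => /andP[]; lra.
  exists (\row_i l i) => _ k; apply/mx_norm_leP => // i.
  by rewrite !mxE.
have /choice[y yP] := pw.
have lipy : lip y.
  move=> s t sd td; apply: (@le_geometric _ _ _ (4 * B)); first by rewrite mulr_ge0.
  move=> k; have := yP s sd k; have := yP t td k; have := lipk k s t sd td.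
  have := ler_distD (yk k t) (y t) (y s); have := ler_distD (yk k s) (yk k t) (y s).
  rewrite (distrC (y t) (yk k t)); rewrite -mulrA; lra.
have stepy := PhiP _ lipy.
have fixy t : `|t| <= d -> Phi y t = y t.
  move=> td; apply/eqP; rewrite -subr_eq0 -normr_le0.
  apply: (@le_geometric _ _ _ (2 * B)); first by rewrite mulr_ge0.
  move=> k; rewrite add0r.
  have pos : 0 <= 2 * (B / 2 ^+ k) by rewrite mulr_ge0// divr_ge0// exprn_ge0.
  have h1 : `|yk k.+1 t - Phi y t| <= 2 * (B / 2 ^+ k) / 2.
    by apply: (step_contract (stepk k) stepy) => // u ud; exact: yP.
  have := yP t td k.+1; move: h1; have := half k.
  have := ler_distD (yk k.+1 t) (Phi y t) (y t).
  rewrite (distrC (Phi y t) (yk k.+1 t)); rewrite -mulrA; lra.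
exists (Phi y); split; first by have [] := stepy.
by move=> t td i; rewrite fixy//; have [_] := stepy; exact.
Qed.

End PicardLipschitz.

Section Picard.
Variables (R : realType) (n : nat) (U : set 'rV[R]_n) (F : 'rV[R]_n -> 'rV[R]_n).
Hypothesis oU : open U.

(** The vector field is Lipschitz in a box around [y0], by the mean value
    theorem and a bound for its partial derivatives.  Precomposed with the
    projection [p] onto a smaller box it satisfies the hypotheses of
    [picard_lipschitz], and the solution stays in that box for a short time. *)
Lemma picard y0 : (forall j, Ck 1 U (fun z => F z 0 j)) -> U y0 ->
  exists d (Y : R -> 'rV[R]_n), [/\ 0 < d, Y 0 = y0 & forall t : R, `|t| < d ->
    U (Y t) /\ forall i, is_derive t 1 (fun u => Y u 0 i) (F (Y t) 0 i)].
Proof.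
move=> F1 Uy0.
pose D z : 'M[R]_n := \matrix_(i, j) partial i (fun z => F z 0 j) z.
have Dc : D z @[z --> y0] --> D y0.
  apply: (@cvg_mx _ _ _ (nbhs_filter y0)) => i j; rewrite mxE.
  apply: cvg_trans (Ck_continuous oU (Ck_partial i (F1 j)) Uy0).
  by apply: (@near_eq_cvg _ _ (nbhs y0)); apply: nearW => z; rewrite mxE.
have [K K0 DK] := cvg_mx_bounded (nbhs_filter y0) Dc.
have : \forall z \near y0, U z /\
    forall i j, `|partial i (fun z => F z 0 j) z| <= K.
  apply: filterI; first exact: open_nbhs_nbhs.
  by apply: filterS DK => z Dz i j; have := Dz i j; rewrite mxE.
move=> /nbhs_ballP[r r0 rP].
have Fd j w i : ball y0 r w -> derivable (fun z => F z 0 j) w (delta_mx 0 i).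
  by move=> /rP[Uw _]; exact: Ck_derivable (F1 j) Uw.
pose L := n%:R * K; have L0 : 0 <= L by rewrite mulr_ge0.
have lipF a b : ball y0 r a -> ball y0 r b -> `|F a - F b| <= L * `|a - b|.
  move=> ra rb; apply/mx_norm_leP; first by rewrite mulr_ge0.
  move=> j; have [xi [xir _ E]] := partial_mvt (Fd j) rb ra.
  rewrite !mxE E; apply: le_trans (ler_norm_sum _ _ _) _.
  rewrite /L -mulrA mulr_natl -[X in _ *+ X]card_ord -sumr_const.
  apply: ler_sum => i _; rewrite normrM mulrC ler_pM//.
    by have [_ /(_ i j)] := rP _ (xir i).
  by have := mx_norm_ge (a - b) i; rewrite !mxE.
have r2 : 0 < r / 2 by rewrite divr_gt0.
have rr : r / 2 < r by rewrite ltr_pdivrMr// ltr_pMr// ltr1n.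
pose p (z : 'rV[R]_n) : 'rV[R]_n := \row_j clip (y0 0 j) (r / 2) (z 0 j).
have pr z : ball y0 r (p z).
  apply/mx_ballP; split=> // j; rewrite distrC mxE.
  by apply: le_lt_trans rr; exact: clip_in (ltW r2).
have pid (z : 'rV[R]_n) : (forall j, `|z 0 j - y0 0 j| <= r / 2) -> p z = z.
  by move=> zr; apply/rowP => j; rewrite mxE clip_id.
have plip (z w : 'rV[R]_n) : `|p z - p w| <= `|z - w|.
  apply/mx_norm_leP => // j; rewrite !mxE.
  apply: le_trans (clip_lipschitz _ _ _ (ltW r2)) _.
  by have := mx_norm_ge (z - w) j; rewrite !mxE.
have pdist (z : 'rV[R]_n) : `|p z - y0| <= r / 2.
  by apply/mx_norm_leP => [|j]; rewrite ?mxE ?clip_in// ltW.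
have y0r : ball y0 r y0 by exact: ballxx.
pose C := `|F y0| + L * (r / 2).
have C0 : 0 <= C by rewrite addr_ge0// mulr_ge0// ltW.
pose d := (2 * (L + 1))^-1.
have d0 : 0 < d by rewrite invr_gt0 mulr_gt0// ltr_wpDl.
have Ld : L * d <= 2^-1.
  rewrite /d invfM mulrCA ler_piMr ?invr_ge0// ler_pdivrMr ?ltr_wpDl//; lra.
have [||Y [Y0 Yd]] := @picard_lipschitz R n (F \o p) L C d y0 L0 C0 d0 Ld.
- move=> z w /=; apply: le_trans (lipF _ _ (pr z) (pr w)) _.
  by rewrite ler_wpM2l// plip.
- move=> z /=; have := lipF _ _ (pr z) y0r.
  have := ler_normD (F y0) (F (p z) - F y0); rewrite addrC subrK.
  move=> h1 h2; apply: le_trans h1 _; rewrite lerD2l; apply: le_trans h2 _.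
  by rewrite ler_wpM2l.
have Yc i : {for 0, continuous (fun u => Y u 0 i)}.
  apply: differentiable_continuous; apply/derivable1_diffP.
  have d00 : `|0 : R| <= d by rewrite normr0 ltW.
  by have [] := Yd 0 d00 i.
have : \forall t \near (0 : R), forall i, `|Y 0 0 i - Y t 0 i| < r / 2.
  apply: (@filter_forall _ _ _ _ (nbhs_filter (0 : R))) => i.
  exact: (@cvgr_dist_lt _ _ _ _ (nbhs_filter (0 : R)) _ _ (Yc i) _ r2).
move=> [e /= e0 eP].
exists (Num.min d e), Y; split=> //; first by rewrite lt_min d0.
move=> t; rewrite lt_min => /andP[td te].
have pY : p (Y t) = Y t.
  apply: pid => j; rewrite distrC -Y0; apply: ltW; apply: eP.
  by rewrite /= sub0r normrN.
split; first by rewrite -pY; have [] := rP _ (pr (Y t)).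
by move=> i; have := Yd t (ltW td) i; rewrite /= pY.
Qed.

End Picard.

Lemma Ck_sub (R : realType) n k (U V : set 'rV[R]_n) (f : 'rV[R]_n -> R) :
  V `<=` U -> Ck k U f -> Ck k V f.
Proof.
move=> VU; elim: k f => [|k ih] f [fc fd].
  by split=> //; exact: continuous_subspaceW fc.
split; first exact: continuous_subspaceW fc.
by move=> i; have [fdi /ih] := fd i; split=> // x /VU; exact: fdi.
Qed.

Lemma smooth_partial (R : realType) n (V : set 'rV[R]_n) i (G : 'rV[R]_n -> R) :
  smooth_on V G -> smooth_on V (partial i G).
Proof. by move=> Gs k; exact: Ck_partial (Gs k.+1). Qed.

Section SmoothAlong.
Variables (R : realType) (n : nat) (U : set 'rV[R]_n) (F : 'rV[R]_n -> 'rV[R]_n).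
Variables (J : set R) (y : R -> 'rV[R]_n).
Hypothesis F_smooth : forall j, smooth_on U (fun z => F z 0 j).
Hypothesis J_interval : nondegenerate_interval J.
Hypothesis yF : forall s, J s -> forall i,
  has_derive_in J (fun u => y u 0 i) s (F (y s) 0 i).

(** Along a solution of y' = F y, the derivative of G o y is
    (lie_derivative G) o y. *)
Definition lie_derivative (G : 'rV[R]_n -> R) z := \sum_i F z 0 i * partial i G z.

Lemma smooth_lie_derivative V G : open V -> V `<=` U ->
  smooth_on V G -> smooth_on V (lie_derivative G).
Proof.
move=> oV VU Gs k; apply: (Ck_sum oV) => i; apply: (CkM oV).
  exact: Ck_sub VU (F_smooth i k).
exact: smooth_partial Gs k.
Qed.

(** Since [lie_derivative] preserves smooth functions, all the derivatives of
    G o y exist: the solution is as smooth as the vector field. *)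
Lemma smooth_along_flow V G f : open V -> V `<=` U -> smooth_on V G ->
  (forall s, J s -> V (y s) -> f s = G (y s)) ->
  forall s, J s -> V (y s) -> smooth_in_at J f s.
Proof.
move=> oV VU.
have fd f' G' s' : smooth_on V G' -> (forall s, J s -> V (y s) -> f' s = G' (y s)) ->
    J s' -> V (y s') -> has_derive_in J f' s' (lie_derivative G' (y s')).
  move=> Gs fG Js' Vs'; apply: (has_derive_in_near (f := fun u => G' (y u))) => //.
    have yc : y u @[u --> within J (nbhs s')] --> y s'.
      apply: cvg_mx => i j; rewrite (ord1 i).
      by apply: has_derive_in_continuous; exact: yF.
    have : \forall u \near within J (nbhs s'), V (y u).
      by apply: yc; exact: open_nbhs_nbhs.
    by rewrite !near_withinE; apply: filterS => u Vu Ju; rewrite fG//; exact: Vu.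
  by apply: (has_derive_in_comp oV Js' (Gs 1%N) Vs') => i; exact: yF.
move=> Gs fG s Js Vs k; elim: k f G Gs fG s Js Vs => [|k ih] f' G' Gs fG s Js Vs.
  exact: has_derive_in_derivable (fd _ _ _ Gs fG Js Vs).
rewrite iterSr; apply: (ih _ (lie_derivative G')) => //.
  exact: smooth_lie_derivative.
by move=> u Ju Vu; apply: derive_inE => //; exact: fd.
Qed.

End SmoothAlong.

(** * Charts, transition maps and curves *)

Section MatrixDerivative.
Variables (R : realType) (I : set R).

Definition mx_derive m n (Y : R -> 'M[R]_(m, n)) s (Y' : 'M[R]_(m, n)) :=
  forall i j, has_derive_in I (fun u => Y u i j) s (Y' i j).

Lemma mx_derive_near m n (X Y : R -> 'M[R]_(m, n)) s Y' : I s ->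
  (\forall u \near within I (nbhs s), X u = Y u) ->
  mx_derive X s Y' -> mx_derive Y s Y'.
Proof.
move=> Is XY XY' i j; apply: has_derive_in_near (XY' i j) => //.
by apply: filterS XY => u ->.
Qed.

Lemma mx_derive_continuous m n (Y : R -> 'M[R]_(m, n)) s Y' :
  mx_derive Y s Y' -> Y u @[u --> within I (nbhs s)] --> Y s.
Proof. by move=> YY'; apply: cvg_mx => i j; exact: has_derive_in_continuous. Qed.

Lemma mx_derive_tr m n (X : R -> 'M[R]_(m, n)) s X' :
  mx_derive X s X' -> mx_derive (fun u => (X u)^T) s X'^T.
Proof.
move=> XX' i j; under [X in has_derive_in _ X]eq_fun do rewrite mxE.
by rewrite mxE; exact: XX'.
Qed.

Lemma mx_deriveM m n p (X : R -> 'M[R]_(m, n)) (Y : R -> 'M[R]_(n, p)) s X' Y' :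
  mx_derive X s X' -> mx_derive Y s Y' ->
  mx_derive (fun u => X u *m Y u) s (X' *m Y s + X s *m Y').
Proof.
move=> XX' YY' i j; under [X in has_derive_in _ X]eq_fun do rewrite mxE.
rewrite !mxE -big_split/=; apply: has_derive_in_sum => k.
exact: has_derive_inM.
Qed.

End MatrixDerivative.

Section Charts.
Variable R : realType.

Section OneChart.
Variables (n : nat) (M : topologicalType) (c : chart R n M).

Definition chart_image := coord c @` dom c.

Lemma chart_imageP x : chart_image x -> dom c (param c x) /\ coord c (param c x) = x.
Proof. by move=> [p cp <-]; rewrite coordK. Qed.

Lemma image_coord p : dom c p -> chart_image (coord c p).
Proof. by move=> cp; exists p. Qed.

Lemma open_chart_image : open chart_image. Proof. exact: image_open. Qed.

Lemma param_cvg x : chart_image x -> param c y @[y --> x] --> param c x.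
Proof.
move=> ix; have /subspace_continuousP/(_ x ix) := @param_continuous _ _ _ c.
by rewrite within_interior//; apply: open_nbhs_nbhs; split => //; exact: open_chart_image.
Qed.

Lemma open_coord_image (W : set M) : open W -> open (coord c @` (dom c `&` W)).
Proof.
move=> oW; rewrite openE => _ [p [cp Wp] <-].
have ip := image_coord cp.
have h1 : \forall y \near coord c p, W (param c y).
  by apply: (param_cvg ip); apply: open_nbhs_nbhs; rewrite coordK.
have h2 : \forall y \near coord c p, chart_image y.
  by apply: open_nbhs_nbhs; split=> //; exact: open_chart_image.
apply: filterS2 h1 h2 => y Wy /chart_imageP[cy E].
by exists (param c y).
Qed.

End OneChart.

Section Transition.
Variables (n n' : nat) (M M' : topologicalType) (f : M -> M').
Variables (c : chart R n M) (d : chart R n' M').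
Hypothesis f_continuous : continuous f.
Hypothesis f_smooth : smooth_rep f c d.

(** The domain of the coordinate representation of [f]. *)
Definition overlap := coord c @` (dom c `&` f @^-1` dom d).

Lemma open_overlap : open overlap.
Proof.
apply: open_coord_image; apply: open_comp; last exact: dom_open.
by move=> x _; exact: f_continuous.
Qed.

Lemma overlap_coord p : dom c p -> dom d (f p) -> overlap (coord c p).
Proof. by move=> cp dp; exists p. Qed.

(** The derivative of the Jacobian matrix of [f] in the direction [v]: the
    Hessians of the components of [f], contracted once with [v]. *)
Definition djac (p : M) (v : 'rV[R]_n) : 'M[R]_(n, n') :=
  \matrix_(b, j) \sum_a v 0 a * partial a (partial b (local_rep f c d j)) (coord c p).

Lemma djac_linear p : linear (djac p).
Proof.
move=> a u v; apply/matrixP => b j; rewrite !mxE mulr_sumr -big_split/=.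
by apply: eq_bigr => k _; rewrite !mxE; ring.
Qed.

Lemma djac_sym p u v : dom c p -> dom d (f p) -> u *m djac p v = v *m djac p u.
Proof.
move=> cp dp; apply/rowP => j; rewrite !mxE.
under eq_bigr do rewrite !mxE mulr_sumr.
rewrite exchange_big/=; apply: eq_bigr => a _; rewrite !mxE mulr_sumr.
apply: eq_bigr => b _.
by rewrite (partialC open_overlap a b (f_smooth j 2) (overlap_coord cp dp)); ring.
Qed.

Section AlongCurve.
Variables (I : set R) (gam : R -> M) (s : R) (v : 'rV[R]_n).
Hypothesis Is : I s.
Hypothesis gam_cvg : gam u @[u --> within I (nbhs s)] --> gam s.
Hypothesis cs : dom c (gam s).
Hypothesis ds : dom d (f (gam s)).
Hypothesis gam_v : mx_derive I (fun u => coord c (gam u)) s v.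

(** Continuity at the single point [s] is assumed here, and not on [I]: the
    lemmas of this section are also applied to coordinate lines, which are
    meaningful only near their origin. *)
Lemma near_dom : \forall u \near within I (nbhs s), dom c (gam u) /\ dom d (f (gam u)).
Proof.
have oW : open (dom c `&` f @^-1` dom d).
  apply: openI; first exact: dom_open.
  by apply: open_comp; [move=> x _; exact: f_continuous|exact: dom_open].
exact: gam_cvg (open_nbhs_nbhs (conj oW (conj cs ds))).
Qed.

Lemma mx_derive_coord_map :
  mx_derive I (fun u => coord d (f (gam u))) s (v *m jac f c d (gam s)).
Proof.
move=> i j; rewrite (ord1 i) mxE.
under eq_bigr do rewrite mxE.
apply: (has_derive_in_near (f := fun u => local_rep f c d j (coord c (gam u)))) => //.
  by apply: filterS near_dom => u [cu _]; rewrite /local_rep coordK.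
apply: (has_derive_in_comp open_overlap Is (f_smooth j 1)) => //.
exact: overlap_coord.
Qed.

Lemma mx_derive_jac : mx_derive I (fun u => jac f c d (gam u)) s (djac (gam s) v).
Proof.
move=> b j; rewrite mxE; under [X in has_derive_in _ X]eq_fun do rewrite mxE.
apply: (has_derive_in_comp open_overlap Is (Ck_partial b (f_smooth j 2))) => //.
exact: overlap_coord.
Qed.

End AlongCurve.

End Transition.

Section Line.
Variables (n : nat) (M : topologicalType) (c : chart R n M) (p : M).
Hypothesis cp : dom c p.

Definition line (v : 'rV[R]_n) (t : R) := param c (coord c p + t *: v).

Lemma line0 v : line v 0 = p. Proof. by rewrite /line scale0r addr0 coordK. Qed.

Lemma affine_derive (x v : 'rV[R]_n) s : mx_derive setT (fun t : R => x + t *: v) s v.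
Proof.
move=> i j; under [X in has_derive_in _ X]eq_fun do rewrite !mxE.
have := has_derive_inD (has_derive_in_cst setT (x i j) s)
  (has_derive_inM (has_derive_in_id setT s) (has_derive_in_cst setT (v i j) s)).
by rewrite mulr0 mul1r addr0 add0r.
Qed.

Lemma affine_cvg (x v : 'rV[R]_n) :
  (fun t : R => x + t *: v) u @[u --> within setT (nbhs (0 : R))] --> x.
Proof. by have := mx_derive_continuous (@affine_derive x v 0); rewrite scale0r addr0. Qed.

Lemma line_cvg v : line v t @[t --> within setT (nbhs (0 : R))] --> line v 0.
Proof.
rewrite line0 -[X in _ --> X](coordK cp).
exact: (cvg_comp _ _ (@affine_cvg (coord c p) v) (param_cvg (image_coord cp))).
Qed.

Lemma line_derive v : mx_derive setT (fun t => coord c (line v t)) 0 v.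
Proof.
apply: mx_derive_near (@affine_derive (coord c p) v 0) => //.
have : \forall t \near within setT (nbhs (0 : R)), chart_image c (coord c p + t *: v).
  exact: (@affine_cvg (coord c p) v _
    (open_nbhs_nbhs (conj (@open_chart_image _ _ c) (image_coord cp)))).
by apply: filterS => t /chart_imageP[].
Qed.

End Line.

Lemma nondegenerate_setT : nondegenerate_interval [set: R].
Proof. by split=> //; exists 0, 1; split=> //; exact: ltr01. Qed.

(** Both sides are read off from the velocity of the image of a coordinate line,
    transported in two steps. *)
Lemma jac_comp n1 n2 n3 (M1 M2 M3 : topologicalType) (f1 : M1 -> M2) (f2 : M2 -> M3)
    (c : chart R n1 M1) (d : chart R n2 M2) (e : chart R n3 M3) p :
  continuous f1 -> continuous f2 -> smooth_rep f1 c d -> smooth_rep f2 d e ->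
  dom c p -> dom d (f1 p) -> dom e (f2 (f1 p)) ->
  jac (f2 \o f1) c e p = jac f1 c d p *m jac f2 d e (f1 p).
Proof.
move=> f1c f2c f1s f2s cp dp ep; apply/matrixP => i j.
have l0 := line0 cp (delta_mx 0 i : 'rV[R]_n1).
have lc := @line_cvg _ _ _ _ cp (delta_mx 0 i); rewrite l0 in lc.
have H1 : mx_derive setT (fun t => coord d (f1 (line c p (delta_mx 0 i) t))) 0
    (delta_mx 0 i *m jac f1 c d p).
  rewrite -[in X in mx_derive _ _ _ X]l0.
  by apply: mx_derive_coord_map => //; rewrite ?l0//; exact: line_derive.
have H2 : mx_derive setT (fun t => coord e (f2 (f1 (line c p (delta_mx 0 i) t)))) 0
    (delta_mx 0 i *m jac f1 c d p *m jac f2 d e (f1 p)).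
  rewrite -[in X in mx_derive _ _ _ X]l0.
  apply: (mx_derive_coord_map f2c f2s
    (gam := f1 \o line c p (delta_mx 0 i))) => //=; rewrite ?l0//.
  exact: (cvg_comp _ _ lc (f1c p)).
have [_ E] := (has_derive_line (local_rep (f2 \o f1) c e j) (coord c p) i _).1 (H2 0 j).
rewrite -mulmxA -rowE mxE in E.
by rewrite mxE E.
Qed.

End Charts.

(** * The Levi-Civita connection in charts *)

Lemma linear_vanish (R : realType) n m p (phi : 'rV[R]_n -> 'M[R]_(m, p)) :
  linear phi -> (forall a, phi (delta_mx 0 a) = 0) -> forall v, phi v = 0.
Proof.
move=> phil phi0 v; rewrite (row_sum_delta v).
have p0 : phi 0 = 0.
  by have := phil (-1) 0 0; rewrite scaler0 addr0 scaleN1r addNr.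
elim: (index_enum _) => [|a r ih]; first by rewrite big_nil.
by rewrite big_cons phil phi0 scaler0 add0r.
Qed.

Section Connection.
Variables (R : realType) (n : nat) (M : manifold R n) (g : metric M).

(** The connection form: nabla_z X = X' + X *m conn z. *)
Definition conn (c : chart R n M) (p : M) (z : 'rV[R]_n) : 'M[R]_n :=
  \matrix_(j, l) \sum_r z 0 r * christoffel g c p r j l.

Lemma conn_linear c p : linear (conn c p).
Proof.
move=> a u v; apply/matrixP => j l; rewrite !mxE mulr_sumr -big_split/=.
by apply: eq_bigr => k _; rewrite !mxE; ring.
Qed.

Lemma christoffel_levi_civita c p : charts_at p c ->
  levi_civita_at g c p (christoffel g c p).
Proof. by move=> cp; exact: (christoffelP g (christoffel g c p) cp).2. Qed.

Lemma conn_sym c p x z : charts_at p c -> x *m conn c p z = z *m conn c p x.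
Proof.
move=> cp; apply/rowP => l; rewrite !mxE.
under eq_bigr do rewrite !mxE mulr_sumr.
rewrite exchange_big/=; apply: eq_bigr => a _; rewrite !mxE mulr_sumr.
apply: eq_bigr => b _; rewrite (christoffel_levi_civita cp).1; ring.
Qed.

Section AlongCurve.
Variables (I : set R) (gam : R -> M) (s : R) (c : chart R n M) (z : 'rV[R]_n).
Hypothesis Is : I s.
Hypothesis gam_cvg : gam u @[u --> within I (nbhs s)] --> gam s.
Hypothesis cs : charts_at (gam s) c.
Hypothesis gam_z : mx_derive I (fun u => coord c (gam u)) s z.

Let A := conn c (gam s) z.
Let G := gram g c (gam s).

(** Compatibility with the metric, as the matrix equation
    G' = A G + G A^T along a curve. *)
Lemma mx_derive_gram :
  mx_derive I (fun u => gram g c (gam u)) s (A *m G + G *m A^T).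
Proof.
move=> j k; have [cM cgs] := cs.
have -> : (A *m G + G *m A^T) j k =
    \sum_r z 0 r * partial r (fun x => gram g c (param c x) j k) (coord c (gam s)).
  rewrite !mxE -big_split/=.
  transitivity (\sum_r z 0 r * dgram g c (gam s) r j k); last by [].
  under [RHS]eq_bigr => r _ do rewrite (christoffel_levi_civita cs).2 mulr_sumr.
  rewrite exchange_big/=; apply: eq_bigr => l _; rewrite !mxE mulr_suml mulr_sumr.
  by rewrite -big_split/=; apply: eq_bigr => r _; rewrite -/G; ring.
apply: (has_derive_in_near (f := fun u => gram g c (param c (coord c (gam u))) j k)) => //.
  have : \forall u \near within I (nbhs s), dom c (gam u).
    exact: gam_cvg (open_nbhs_nbhs (conj (@dom_open _ _ _ c) cgs)).
  by apply: filterS => u cu; rewrite coordK.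
apply: (has_derive_in_comp (@open_chart_image _ _ _ c) Is (gram_smooth g j k cM 1)) => //.
exact: image_coord.
Qed.

(** The rule <X, Y>' = <nabla X, Y> + <X, nabla Y>, for all the rows of [X] and
    [Y] at once. *)
Lemma metric_compat p q (X : R -> 'M[R]_(p, n)) (Y : R -> 'M[R]_(q, n)) X' Y' :
  mx_derive I X s X' -> mx_derive I Y s Y' ->
  mx_derive I (fun u => X u *m gram g c (gam u) *m (Y u)^T) s
    ((X' + X s *m A) *m G *m (Y s)^T + X s *m G *m (Y' + Y s *m A)^T).
Proof.
move=> XX' YY'; have := mx_deriveM (mx_deriveM XX' mx_derive_gram) (mx_derive_tr YY').
have trD : (Y' + Y s *m A)^T = Y'^T + A^T *m (Y s)^T by rewrite linearD/= trmx_mul.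
congr mx_derive; rewrite -/G trD !mulmxDl !mulmxDr !mulmxA mulmxDl.
by rewrite -!addrA; congr (_ + (_ + _)); rewrite addrC.
Qed.

End AlongCurve.

Lemma cov_deriveE I (gam : R -> M) (V : R -> tvec M) s c X' z :
  nondegenerate_interval I -> I s ->
  mx_derive I (fun u => V u c) s X' -> velocity I gam s c = z ->
  cov_derive g I gam V s c = X' + V s c *m conn c (gam s) z.
Proof.
move=> Iitv Is VX vz; apply/rowP => k; rewrite !mxE (derive_inE Iitv Is (VX 0 k)).
congr (_ + _); rewrite vz exchange_big/=; apply: eq_bigr => j _.
rewrite !mxE mulr_sumr; apply: eq_bigr => i _; ring.
Qed.

Lemma velocityE I (gam : R -> M) s c z :
  nondegenerate_interval I -> I s ->
  mx_derive I (fun u => coord c (gam u)) s z -> velocity I gam s c = z.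
Proof.
by move=> Iitv Is gz; apply/rowP => j; rewrite mxE (derive_inE Iitv Is (gz 0 j)).
Qed.

End Connection.

Section Maps.
Variables (R : realType) (n n' : nat) (N : manifold R n) (M : manifold R n').
Variables (h : metric N) (g : metric M) (f : N -> M).
Hypothesis f_smooth : smooth_map f.
Variables (c : chart R n N) (d : chart R n' M).

(** The covariant derivative of the differential of [f]: if W is a field along
    a curve of velocity [v] and J the Jacobian matrix of [f], then
    nabla (W J) = (nabla W) J + W *m second_form v.  For an isometric immersion
    it is the second fundamental form. *)
Definition second_form (p : N) (v : 'rV[R]_n) : 'M[R]_(n, n') :=
  let J := jac f c d p in
  djac f c d p v + J *m conn g d (f p) (v *m J) - conn h c p v *m J.

Lemma second_form_linear p : linear (second_form p).
Proof.
move=> a u v; rewrite /second_form djac_linear mulmxDl -scalemxAl !conn_linear.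
rewrite mulmxDr mulmxDl -scalemxAr -scalemxAl.
apply/matrixP => i j; rewrite !mxE; ring.
Qed.

(** Symmetry of the Hessians of [f] and of the two connections. *)
Lemma second_form_sym p u v : charts_at p c -> charts_at (f p) d ->
  u *m second_form p v = v *m second_form p u.
Proof.
move=> cp dp; have [_ fs] := f_smooth.
rewrite /second_form !mulmxBr !mulmxDr !mulmxA.
rewrite (djac_sym (f_smooth.1) (fs c d cp.1 dp.1) u v cp.2 dp.2).
by rewrite (conn_sym g (u *m _) (v *m _) dp) (conn_sym h u v cp).
Qed.

Lemma second_form_polarization p : charts_at p c -> charts_at (f p) d ->
  (forall v, v *m second_form p v = 0) -> forall v, second_form p v = 0.
Proof.
move=> cp dp B0 v; apply/row_matrixP => i; rewrite row0 rowE.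
have Bs u := second_form_sym v u cp dp.
move: B0 Bs (second_form_linear p); move: (second_form p) => B B0 Bs Bl.
set w := delta_mx 0 i; have := B0 (1 *: v + w).
rewrite Bl !scale1r mulmxDl !mulmxDr !B0 addr0 add0r Bs -mulr2n => /matrixP Bw.
apply/matrixP => a b.
have /eqP : (w *m B v) a b *+ 2 = 0 by rewrite -mulmxnE Bw mxE.
by rewrite mulrn_eq0/= => /eqP ->; rewrite mxE.
Qed.

Lemma cov_derive_velocity_map I (gam : R -> N) s (v : R -> 'rV[R]_n) w :
  nondegenerate_interval I -> I s ->
  (forall u, I u -> gam x @[x --> within I (nbhs u)] --> gam u) ->
  charts_at (gam s) c -> charts_at (f (gam s)) d ->
  (\forall u \near within I (nbhs s), mx_derive I (fun x => coord c (gam x)) u (v u)) ->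
  mx_derive I v s w ->
  velocity I (f \o gam) s d = v s *m jac f c d (gam s) /\
  cov_derive g I (f \o gam) (velocity I (f \o gam)) s d =
    (w + v s *m conn h c (gam s) (v s)) *m jac f c d (gam s) +
    v s *m second_form (gam s) (v s).
Proof.
move=> Iitv Is gc cs ds gv vw; have [fc fs] := f_smooth.
have fcd := fs c d cs.1 ds.1.
have gvs : mx_derive I (fun x => coord c (gam x)) s (v s) by exact: (nbhs_singleton gv).
have vel : \forall u \near within I (nbhs s),
    velocity I (f \o gam) u d = v u *m jac f c d (gam u).
  have := near_dom fc (gc s Is) cs.2 ds.2; move: gv.
  rewrite !near_withinE; apply: filterS2 => u gvu cdu Iu.
  have [cu du] := cdu Iu.
  apply: velocityE => //; apply: (mx_derive_coord_map fc fcd Iu (gc u Iu) cu du).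
  exact: gvu.
have vels : velocity I (f \o gam) s d = v s *m jac f c d (gam s).
  exact: (nbhs_singleton vel).
split=> //.
have dJ := mx_derive_jac fc fcd Is cs.2 ds.2 gvs.
have dv : mx_derive I (fun u => velocity I (f \o gam) u d) s
    (w *m jac f c d (gam s) + v s *m djac f c d (gam s) (v s)).
  apply: mx_derive_near (mx_deriveM vw dJ) => //.
  by apply: filterS vel => u ->.
rewrite (cov_deriveE g Iitv Is dv vels) vels /second_form.
rewrite mulmxBr mulmxDr mulmxDl !mulmxA /=.
by rewrite -[RHS]addrA [X in _ = _ + X]addrC subrK addrA.
Qed.

End Maps.

(** * Independence of the chart *)

Section Change.
Variables (R : realType) (n : nat) (N : manifold R n) (h : metric N).

Lemma smooth_map_id : smooth_map (id : N -> N).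
Proof.
split; first by move=> x; exact: cvg_id.
by move=> c d cN dN; have [] := atlas_compatible cN dN.
Qed.

(** The transformation law of the Christoffel symbols.  Differentiating
    gram c = J (gram d) J^T shows that the connection of [d], pulled back to [c]
    as the matrices [P] below, is compatible with the metric; it is torsion free
    by symmetry of the second derivatives, so it is the connection of [c]. *)
Lemma christoffel_change (c d : chart R n N) p v :
  charts_at p c -> charts_at p d -> second_form h h id c d p v = 0.
Proof.
move=> cp dp; have [idc ids] := smooth_map_id; have cd := ids c d cp.1 dp.1.
have hcd q : charts_at q c -> charts_at q d ->
    gram h c q = jac id c d q *m gram h d q *m (jac id c d q)^T.
  exact: gram_change.
set J := jac id c d p.
have JU : J \in unitmx.
  by have := gram_unit h cp; rewrite hcd// !unitmx_mul => /andP[/andP[]].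
pose P w := (djac id c d p w + J *m conn h d p (w *m J)) *m invmx J.
have PJ w : P w *m J = djac id c d p w + J *m conn h d p (w *m J) by rewrite mulmxKV.
have PE : forall a i l, P (delta_mx 0 a) i l = christoffel h c p a i l.
  apply/(christoffelP h _ cp); split=> [a i l|a j k].
    have E b w : P w b l = ((delta_mx 0 b : 'rV[R]_n) *m
        (djac id c d p w + J *m conn h d p (w *m J)) *m invmx J) 0 l.
      by rewrite -mulmxA -rowE [RHS]mxE.
    rewrite !E; congr ((_ *m _) _ _); rewrite !mulmxDr !mulmxA.
    by rewrite (djac_sym idc cd _ _ cp.2 dp.2) (conn_sym h _ _ dp).
  set e := delta_mx 0 a.
  have l0 := line0 cp.2 e; have lc0 := @line_cvg _ _ _ _ _ cp.2 e.
  have lc := lc0; rewrite l0 in lc.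
  have ld := @line_derive _ _ _ _ _ cp.2 e.
  have D1 : has_derive_in setT (fun t => gram h c (line c p e t) j k) 0 (dgram h c p a j k).
    apply: (Ck_line (U := chart_image c) (k := 0)); first exact: (gram_smooth h j k cp.1 1).
    exact: image_coord cp.2.
  set G := gram h d p; set A := conn h d p (e *m J); set K := djac id c d p e.
  have dl : mx_derive setT (fun t => coord d (line c p e t)) 0 (e *m J).
    have := @mx_derive_coord_map _ _ _ _ _ _ _ _ idc cd setT (line c p e) 0 e.
    by rewrite l0; apply=> //; [exact: cp.2|exact: dp.2].
  have dG : mx_derive setT (fun t => gram h d (line c p e t)) 0 (A *m G + G *m A^T).
    have := @mx_derive_gram _ _ _ h setT (line c p e) 0 d (e *m J).
    by rewrite l0; apply.
  have dJ : mx_derive setT (fun t => jac id c d (line c p e t)) 0 K.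
    have := @mx_derive_jac _ _ _ _ _ _ _ _ idc cd setT (line c p e) 0 e.
    by rewrite l0; apply=> //; [exact: cp.2|exact: dp.2].
  have D2 := mx_deriveM (mx_deriveM dJ dG) (mx_derive_tr dJ).
  rewrite l0 -/G -/J in D2.
  have D3 : mx_derive setT (fun t => gram h c (line c p e t)) 0
     (P e *m gram h c p + gram h c p *m (P e)^T).
    have -> : P e *m gram h c p + gram h c p *m (P e)^T =
        (K *m G + J *m (A *m G + G *m A^T)) *m J^T + J *m G *m K^T.
      rewrite hcd// -/J -/G !mulmxA PJ -/A -/K.
      rewrite -(mulmxA _ J^T) -trmx_mul PJ -/A -/K.
      have trD : (K + J *m A)^T = K^T + A^T *m J^T by rewrite linearD/= trmx_mul.
      rewrite trD !mulmxDl !mulmxDr !mulmxA mulmxDl.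
      by rewrite -!addrA; congr (_ + (_ + _)); rewrite addrC.
    apply: mx_derive_near D2 => //.
    have : \forall t \near within setT (nbhs (0 : R)),
        dom c (line c p e t) /\ dom d (line c p e t).
      by apply: (near_dom idc lc0); rewrite l0; [exact: cp.2|exact: dp.2].
    apply: filterS => t [ct dt]; rewrite [RHS]hcd//; split=> //; [exact: cp.1|exact: dp.1].
  rewrite -(derive_inE (nondegenerate_setT R) I D1).
  rewrite (derive_inE (nondegenerate_setT R) I (D3 j k)) mxE [X in X + _]mxE [X in _ + X]mxE.
  rewrite -big_split/=; apply: eq_bigr => l _; rewrite [(P e)^T _ _]mxE.
  by rewrite [X in _ + X = _]mulrC.
apply: (linear_vanish (second_form_linear h h id c d p)) => a.
rewrite /second_form -/J -PJ -mulmxBl.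
suff -> : conn h c p (delta_mx 0 a) = P (delta_mx 0 a) by rewrite subrr mul0mx.
apply/matrixP => i l; rewrite PE mxE (bigD1 a)//= mxE !eqxx mul1r big1 ?addr0// => r ra.
by rewrite mxE (negPf ra) andbF mul0r.
Qed.

End Change.

Section SmoothChristoffel.
Variables (R : realType).

Lemma Ck_det n p k (U : set 'rV[R]_n) (A : 'rV[R]_n -> 'M[R]_p) : open U ->
  (forall i j, Ck k U (fun x => A x i j)) -> Ck k U (fun x => \det (A x)).
Proof.
move=> oU Ak; apply: (Ck_sum oU) => s; apply: (CkM oU); first exact: Ck_cst.
by apply: (Ck_prod oU) => i; exact: Ak.
Qed.

Lemma Ck_invmx n p k (U : set 'rV[R]_n) (A : 'rV[R]_n -> 'M[R]_p) i j : open U ->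
  (forall x, U x -> A x \in unitmx) ->
  (forall i j, Ck k U (fun x => A x i j)) -> Ck k U (fun x => invmx (A x) i j).
Proof.
move=> oU AU Ak.
apply: (@Ck_eq _ _ _ oU _
  (fun x => (\det (A x))^-1 * ((-1) ^+ (j + i) * \det (row' j (col' i (A x)))))) => //.
  by move=> x Ux; rewrite /invmx AU// !mxE.
apply: (CkM oU).
  apply: (Ck_inv oU); last exact: Ck_det.
  by move=> x Ux; have := AU x Ux; rewrite unitmxE unitfE.
apply: (CkM oU); first exact: Ck_cst.
apply: (Ck_det oU) => a b.
by under [X in Ck _ _ X]eq_fun do rewrite !mxE; exact: Ak.
Qed.

Variables (n : nat) (N : manifold R n) (h : metric N).

Lemma smooth_christoffel (c : chart R n N) i j k : atlas c ->
  smooth_on (chart_image c) (fun x => christoffel h c (param c x) i j k).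
Proof.
move=> cN r; have oU := @open_chart_image _ _ _ c.
have dg a b e : Ck r (chart_image c) (fun x => dgram h c (param c x) a b e).
  apply: (@Ck_eq _ _ _ oU _ (partial a (fun x => gram h c (param c x) b e))).
    by move=> x /chart_imageP[_ E]; rewrite /dgram E.
  exact: (smooth_partial a (gram_smooth h b e cN)).
rewrite /christoffel; apply: (CkM oU); first exact: Ck_cst.
apply: (Ck_sum oU) => l; apply: (CkM oU).
  apply: Ck_invmx => // [x /chart_imageP[cx _]|a b]; first exact: gram_unit.
  exact: (gram_smooth h a b cN).
under [X in Ck _ _ X]eq_fun do rewrite -mulN1r.
by apply: (CkD oU); [apply: (CkD oU)|apply: (CkM oU); [exact: Ck_cst|]].
Qed.

End SmoothChristoffel.

(** * Geodesics and the second fundamental form *)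

Section GeodesicFlow.
Variables (R : realType) (n : nat) (N : manifold R n) (h : metric N).
Variables (c : chart R n N).
Hypothesis cN : atlas c.

(* Positions and velocities form one row vector of length n + n. *)
Let state (W : set 'rV[R]_n) := [set z : 'rV[R]_(n + n) | W (lsubmx z)].

Let open_state W : open W -> open (state W).
Proof.
move=> oW; apply: open_comp => // z _; apply: (@cvg_mx _ _ _ (nbhs_filter z)) => i j.
by under eq_cvg do rewrite mxE; rewrite mxE; exact: matrix_normedtype.coord_continuous.
Qed.

Let smooth_state W (G : 'rV[R]_n -> R) : open W -> smooth_on W G ->
  smooth_on (state W) (fun z => G (lsubmx z)).
Proof.
move=> oW Gs k; apply: (Ck_comp (open_state oW) oW) (Gs k) => // j.
by under [X in Ck _ _ X]eq_fun do rewrite mxE; exact: (Ck_coord (open_state oW)).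
Qed.

Definition geodesic_spray (z : 'rV[R]_(n + n)) : 'rV[R]_(n + n) :=
  row_mx (rsubmx z) (- (rsubmx z *m conn h c (param c (lsubmx z)) (rsubmx z))).

Let O := chart_image c.
Let oO : open O. Proof. exact: open_chart_image. Qed.

Lemma smooth_geodesic_spray j : smooth_on (state O) (fun z => geodesic_spray z 0 j).
Proof.
move=> k; have oU := open_state oO.
have rsub i : Ck k (state O) (fun z => rsubmx z 0 i).
  by under [X in Ck _ _ X]eq_fun do rewrite mxE; exact: Ck_coord.
case: (split_ordP j) => i ->.
  by under [X in Ck _ _ X]eq_fun do rewrite row_mxEl; exact: rsub.
under [X in Ck _ _ X]eq_fun do rewrite row_mxEr mxE -mulN1r mxE.
apply: (CkM oU); first exact: Ck_cst.
apply: (Ck_sum oU) => a; apply: (CkM oU) => //.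
under [X in Ck _ _ X]eq_fun do rewrite mxE.
apply: (Ck_sum oU) => r; apply: (CkM oU) => //.
exact: (smooth_state oO (smooth_christoffel h r a i cN)).
Qed.

(** An integral curve of the geodesic spray, read in the chart [c].  In another
    chart its acceleration is the one in [c] times the Jacobian matrix, by
    [christoffel_change]. *)
Lemma exists_geodesic p v : dom c p ->
  exists (J : set R) (gam : R -> N) (V : R -> 'rV[R]_n),
  [/\ geodesic h J gam, J 0, gam 0 = p, V 0 = v & forall u, J u ->
    [/\ gam x @[x --> within J (nbhs u)] --> gam u, dom c (gam u),
        mx_derive J (fun x => coord c (gam x)) u (V u) &
        mx_derive J V u (- (V u *m conn h c (gam u) (V u)))]].
Proof.
move=> cp; have oU := open_state oO.
have U0 : state O (row_mx (coord c p) v).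
  by rewrite /state/= row_mxKl; exact: image_coord.
have [d [Y [d0 Y0 Yd]]] := picard oU (fun j => smooth_geodesic_spray j 1) U0.
pose J := [set t : R | `|t| < d].
have nJ s : J s -> nbhs s J.
  move=> Js; exists (d - `|s|); first by rewrite /= subr_gt0.
  move=> u /= su; have := ler_distD s u 0; rewrite !subr0 distrC => h1.
  by apply: (le_lt_trans h1); rewrite -ltrBrDr.
have J0 : J 0 by rewrite /J/= normr0.
have Jitv : nondegenerate_interval J.
  split.
    move=> a b; rewrite /J/= !ltr_norml => /andP[a1 _] /andP[_ b2] x /andP[ax xb].
    by rewrite /= ltr_norml (lt_le_trans a1)//= (le_lt_trans xb).
  exists 0, (d / 2); split=> //; last by rewrite divr_gt0.
  by rewrite /J/= gtr0_norm ?divr_gt0// ltr_pdivrMr// ltr_pMr// ltr1n.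
have yF s : J s -> forall i, has_derive_in J (fun u => Y u 0 i) s (geodesic_spray (Y s) 0 i).
  by move=> Js i; apply/(has_derive_inP _ _ (nJ s Js)); have [_] := Yd s Js; exact.
pose x u := lsubmx (Y u); pose V u := rsubmx (Y u).
pose gam u := param c (x u).
have Ox u : J u -> O (x u) by move=> /Yd[].
have cgam u : J u -> dom c (gam u) /\ coord c (gam u) = x u.
  by move=> /Ox/chart_imageP.
have xd u : J u -> mx_derive J x u (V u).
  move=> Ju i j; rewrite (ord1 i).
  under [X in has_derive_in _ X]eq_fun do rewrite mxE.
  by have := yF u Ju (lshift n j); rewrite row_mxEl.
have Vd u : J u -> mx_derive J V u (- (V u *m conn h c (gam u) (V u))).
  move=> Ju i j; rewrite (ord1 i).
  under [X in has_derive_in _ X]eq_fun do rewrite mxE.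
  by have := yF u Ju (rshift n j); rewrite row_mxEr.
have gc u : J u -> gam x @[x --> within J (nbhs u)] --> gam u.
  by move=> Ju; exact: (cvg_comp _ _ (mx_derive_continuous (xd u Ju)) (param_cvg (Ox u Ju))).
have gd u : J u -> mx_derive J (fun x => coord c (gam x)) u (V u).
  move=> Ju; apply: mx_derive_near (xd u Ju) => //.
  by rewrite near_withinE; apply: nearW => w /cgam[].
have gam0 : gam 0 = p by rewrite /gam /x Y0 row_mxKl coordK.
exists J, gam, V; split=> //; last first.
- move=> u Ju; split; [exact: gc|exact: (cgam u Ju).1|exact: gd|exact: Vd].
- by rewrite /V Y0 row_mxKr.
split=> //.
- split; first by apply/subspace_continuousP => u Ju; exact: gc.
  move=> s c' Js c's j; have [idc ids] := smooth_map_id N.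
  have cc' := ids c c' cN c's.1.
  have oW := open_overlap idc (c := c) (d := c').
  apply: (smooth_along_flow smooth_geodesic_spray Jitv yF
    (V := state (overlap id c c')) (G := fun z => local_rep id c c' j (lsubmx z))) => //.
  + exact: open_state.
  + by move=> z [q [cq _] E]; rewrite /state/= -E; exact: image_coord.
  + exact: smooth_state.
  + rewrite /state/= -[lsubmx _](cgam s Js).2.
    by apply: overlap_coord; [exact: (cgam s Js).1|exact: c's.2].
move=> s c' Js c's.
have gdn : \forall u \near within J (nbhs s), mx_derive J (fun x => coord c (gam x)) u (V u).
  by rewrite near_withinE; apply: nearW => u; exact: gd.
have [_ ->] := @cov_derive_velocity_map _ _ _ _ _ h h id (smooth_map_id N) c c' J gam s V
  (- (V s *m conn h c (gam s) (V s))) Jitv Js gc (conj cN (cgam s Js).1) c's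
  gdn (Vd s Js).
rewrite addNr mul0mx add0r christoffel_change ?mulmx0//; split=> //; exact: (cgam s Js).1.
Qed.

End GeodesicFlow.

Section TotallyGeodesic.
Variables (R : realType) (n n' : nat) (N : manifold R n) (M : manifold R n').
Variables (h : metric N) (g : metric M) (iota : N -> M).
Hypothesis iota_smooth : smooth_map iota.
Hypothesis N_geodesic : totally_geodesic iota g h.

(** A geodesic of N with velocity [v] at [p] has vanishing acceleration both in
    N and in M; the difference of the two is v *m second_form v. *)
Lemma totally_geodesic_second_form c d p v :
  charts_at p c -> charts_at (iota p) d -> second_form h g iota c d p v = 0.
Proof.
move=> cp dp; apply: (second_form_polarization iota_smooth cp dp) => {}v.
have [J [gam [V [geo J0 g0 V0 gP]]]] := exists_geodesic h cp.1 v cp.2.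
have [Jitv _ geoE] := N_geodesic geo.
have [gc0 _ gd0 Vd0] := gP 0 J0; rewrite -g0 in cp dp.
have gc u : J u -> gam x @[x --> within J (nbhs u)] --> gam u by move=> /gP[].
have gd : \forall u \near within J (nbhs 0), mx_derive J (fun x => coord c (gam x)) u (V u).
  by rewrite near_withinE; apply: nearW => u /gP[].
have [_] := cov_derive_velocity_map h g iota_smooth Jitv J0 gc cp dp gd Vd0.
by rewrite geoE// addNr mul0mx add0r g0 V0.
Qed.

End TotallyGeodesic.

(** * Linear differential equations: uniqueness *)

Section LinearODE.
Variables (R : realType).

(** f exp(-K u) is nonincreasing and f exp(K u) nondecreasing, which gives the
    two directions. *)
Lemma gronwall_zero (f df : R -> R) (a b K : R) : a <= b ->
  (forall u, u \in `]a, b[ -> is_derive u 1 f (df u)) ->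
  {within `[a, b], continuous f} -> (forall u, 0 <= f u) ->
  (forall u, u \in `]a, b[ -> `|df u| <= K * f u) ->
  (f a = 0 <-> f b = 0).
Proof.
move=> ab fd fc f0 dfK.
(* the mean value theorem for f exp(L u), to be used with L = -K and L = K *)
have H L : exists2 c, c \in `[a, b] & (a < b -> c \in `]a, b[) /\
    f b * expR (L * b) - f a * expR (L * a) =
    (df c + L * f c) * expR (L * c) * (b - a).
  have [ltab|] := ltP a b; last first.
    move=> ba; have <- : a = b by apply/eqP; rewrite eq_le ab ba.
    exists a; first by rewrite in_itv/= lexx.
    by split=> //; rewrite !subrr mulr0.
  pose G u := f u * expR (L * u).
  have ed (u : R) : is_derive u 1 (fun u => expR (L * u)) (L * expR (L * u)).
    have lin : is_derive u 1 (fun u : R => L * u) L.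
      have := is_deriveZ (L) (is_derive_id u 1).
      by rewrite /GRing.scale/= mulr1.
    by have := is_derive1_comp (is_derive_expR (L * u)) lin; rewrite mulrC.
  have Gd (u : R) : u \in `]a, b[ -> is_derive u 1 G ((df u + L * f u) * expR (L * u)).
    move=> uab; have := is_deriveM (fd u uab) (ed u).
    by rewrite /GRing.scale/= => h; apply: is_derive_eq h _; ring.
  have Gc : {within `[a, b], continuous G}.
    apply/subspace_continuousP => x xab.
    have /subspace_continuousP/(_ x xab) fx := fc.
    apply: cvgM fx _; apply: cvg_within_filter.
    suff : {for x, continuous (fun u => expR (L * u))} by [].
    by apply: differentiable_continuous; apply/derivable1_diffP; have [] := ed x.
  have [c cab E] := @MVT R G _ a b ltab Gd Gc.
  exists c; first exact: subset_itv_oo_cc.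
  by split=> //; rewrite -E.
have [eqab|neab] := eqVneq a b; first by rewrite eqab.
have ltab : a < b by rewrite lt_neqAle neab.
have ba : 0 <= b - a by rewrite subr_ge0.
split=> [fa|fb].
- have [c _ [/(_ ltab) cab]] := H (- K); rewrite fa mul0r subr0 => E.
  have /ler_normlP[_ d2] := dfK c cab.
  have : f b * expR (- K * b) <= 0.
    by rewrite E mulr_le0_ge0// mulr_le0_ge0 ?expR_ge0//; lra.
  rewrite pmulr_lle0 ?expR_gt0// => fb0.
  by apply/eqP; rewrite eq_le fb0 f0.
- have [c _ [/(_ ltab) cab]] := H K; rewrite fb mul0r sub0r => E.
  have /ler_normlP[d1 _] := dfK c cab.
  have : 0 <= - (f a * expR (K * a)).
    by rewrite E mulr_ge0// mulr_ge0 ?expR_ge0//; lra.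
  rewrite -mulNr pmulr_lge0 ?expR_gt0// oppr_ge0 => fa0.
  by apply/eqP; rewrite eq_le fa0 f0.
Qed.

(** [gronwall_zero] for the square of the Euclidean norm of [F]; as each entry
    of [B] is bounded by [K], its derivative is at most 2 K n^2 times itself. *)
Lemma linear_ode_zero (I : set R) n (F : R -> 'rV[R]_n) (B : R -> 'M[R]_n) K a b :
  is_interval I -> I a -> I b -> a <= b ->
  (forall u, a <= u <= b -> mx_derive I F u (F u *m B u)) ->
  (forall u i j, a <= u <= b -> `|B u i j| <= K) ->
  (F a = 0 <-> F b = 0).
Proof.
move=> Iitv Ia Ib ab FB BK.
pose f u := \sum_i F u 0 i * F u 0 i.
pose df u := \sum_i ((F u *m B u) 0 i * F u 0 i + F u 0 i * (F u *m B u) 0 i).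
have f0 u : 0 <= f u by apply: sumr_ge0 => i _; rewrite -expr2 sqr_ge0.
have fF u : f u = 0 <-> F u = 0.
  split=> [/eqP|Fu]; last by rewrite /f big1// => i _; rewrite Fu mxE mulr0.
  rewrite psumr_eq0 => [/allP fu|i _]; last by rewrite -expr2 sqr_ge0.
  apply/rowP => i; have := fu i (mem_index_enum _); rewrite /= mxE mulf_eq0 orbb.
  by move=> /eqP.
rewrite -!fF.
have fd u : a <= u <= b -> has_derive_in I f u (df u).
  by move=> uab; apply: has_derive_in_sum => i; apply: has_derive_inM; exact: FB.
have itvI u : a <= u <= b -> I u by exact: Iitv.
apply: (@gronwall_zero f df a b (n%:R * n%:R * (2 * K))) => //.
- move=> u; rewrite in_itv/= => /andP[au ub].
  apply/(has_derive_inP (I := I)); last by apply: fd; rewrite !ltW.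
  have : nbhs u `]a, b[%classic by apply: near_in_itvoo; rewrite in_itv/= au.
  apply: filterS => x /=; rewrite in_itv/= => /andP[ax xb].
  by apply: itvI; rewrite !ltW.
- apply/subspace_continuousP => u /=; rewrite in_itv/= => uab.
  move=> A /(has_derive_in_continuous (fd u uab)) h.
  change (\forall x \near within `[a, b]%classic (nbhs u), A (f x)).
  have {h} : \forall x \near within I (nbhs u), A (f x) by exact: h.
  rewrite !near_withinE; apply: filterS => x /= h; rewrite in_itv/= => /itvI; exact: h.
- move=> u; rewrite in_itv/= => /andP[/ltW au /ltW ub].
  have uab : a <= u <= b by rewrite au.
  rewrite /df (eq_bigr (fun i => \sum_j (F u 0 j * B u j i * F u 0 i *+ 2))); last first.
    move=> i _; rewrite mulrC -mulr2n mxE mulr_sumr -sumrMnl.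
    by apply: eq_bigr => j _; congr (_ *+ 2); ring.
  apply: le_trans (ler_norm_sum _ _ _) _.
  rewrite -!mulrA mulr_natl -[X in _ *+ X]card_ord -sumr_const; apply: ler_sum => i _.
  apply: le_trans (ler_norm_sum _ _ _) _.
  rewrite mulr_natl -[X in _ *+ X]card_ord -sumr_const; apply: ler_sum => j _.
  have fij k : F u 0 k * F u 0 k <= f u.
    by rewrite /f (bigD1 k)//= lerDl; apply: sumr_ge0 => l _; rewrite -expr2 sqr_ge0.
  have fg : `|F u 0 j| * `|F u 0 i| <= f u.
    have nij k : `|F u 0 k| * `|F u 0 k| <= f u.
      by rewrite -normrM ger0_norm// -expr2 sqr_ge0.
    have := nij i; have := nij j; have := sqr_ge0 (`|F u 0 j| - `|F u 0 i|).
    by rewrite expr2; nra.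
  rewrite normrMn -[leLHS]mulr_natl ler_wpM2l// !normrM mulrAC mulrC ler_pM//.
  exact: BK.
Qed.

End LinearODE.

(** * Normal fields along the curve *)

Lemma interval_propagation (R : realType) (I : set R) (P : R -> Prop) : is_interval I ->
  (forall s, I s -> exists2 e, 0 < e & forall a b, I a -> I b ->
     `|s - a| < e -> `|s - b| < e -> P a -> P b) ->
  forall s0 s, I s0 -> I s -> P s0 -> P s.
Proof.
move=> /connected_intervalP Iconn Ploc s0 s Is0 Is Ps0.
have /choice[e eP] t : exists e, I t -> 0 < e /\ forall a b, I a -> I b ->
     `|t - a| < e -> `|t - b| < e -> P a -> P b.
  have [It|nIt] := pselect (I t); last by exists 0.
  by have [e e0 eP] := Ploc t It; exists e.
have inball t : I t -> `|t - t| < e t by move=> /eP[e0 _]; rewrite subrr normr0.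
pose C := \bigcup_(t in I `&` P) ball t (e t).
pose D := \bigcup_(t in I `&` ~` P) ball t (e t).
have oC : open C by apply: bigcup_open => t _; exact: ball_open.
have oD : open D by apply: bigcup_open => t _; exact: ball_open.
have CP x : I x -> C x -> P x.
  move=> Ix [t [It Pt]] tx; have [_] := eP t It; apply; last exact: Pt.
  - exact: It.
  - exact: Ix.
  - exact: inball.
  - exact: tx.
have DP x : I x -> D x -> ~ P x.
  move=> Ix [t [It nPt]] tx Px; apply: nPt; have [_] := eP t It; apply; last exact: Px.
  - exact: Ix.
  - exact: It.
  - exact: tx.
  - exact: inball.
suff IP : I `&` P = I by have [] : (I `&` P) s by rewrite IP.
apply: Iconn; first by exists s0.
- exists C => //; apply/seteqP; split=> [x [Ix Px]|x [Ix Cx]]; split=> //; last exact: CP.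
  by exists x => //; exact: inball.
- exists (~` D); first exact: open_closedC.
  apply/seteqP; split=> [x [Ix Px]|x [Ix Dx]]; split=> //; first by move=> /(DP x Ix).
  apply: contrapT => nPx; apply: Dx; exists x => //; exact: inball.
Qed.

(** The scalar products of [X] with the images in M of the coordinate vectors
    of [c]. *)
Definition tangent_products (R : realType) n n' (N : manifold R n)
    (M : manifold R n') (iota : N -> M) (g : metric M)
    (c : chart R n N) (d : chart R n' M) (p : N) (X : tvec M) : 'rV[R]_n :=
  X d *m gram g d (iota p) *m (jac iota c d p)^T.

Definition normal_to (R : realType) n n' (N : manifold R n)
    (M : manifold R n') (iota : N -> M) (g : metric M) (p : N) (X : tvec M) :=
  forall c d, charts_at p c -> charts_at (iota p) d ->
    tangent_products iota g c d p X = 0.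

Definition frame_combination (R : realType) n m (M : manifold R n)
    (nu : 'I_m -> R -> tvec M) (a : 'I_m -> R) (u : R) : tvec M :=
  fun d => \sum_i a i *: nu i u d.

Section AlongCurve.
Variables (R : realType) (m : nat).
Variables (M : manifold R m.+1) (g : metric M).
Variables (N : manifold R m) (iota : N -> M) (h : metric N).
Hypothesis iota_smooth : smooth_map iota.
Hypothesis h_induced : induced_metric iota g h.
Hypothesis second_form0 : forall c d p v,
  charts_at p c -> charts_at (iota p) d -> second_form h g iota c d p v = 0.
Variables (I : set R) (alpha : R -> N).
Hypothesis I_interval : nondegenerate_interval I.
Hypothesis alpha_smooth : smooth_curve I alpha.

Let beta := iota \o alpha.
Let v (c : chart R m N) u : 'rV[R]_m := velocity I alpha u c.
Let w (c : chart R m N) u : 'rV[R]_m := \row_j derive_in I (fun x => v c x 0 j) u.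
(* the acceleration of the curve in N *)
Let q (c : chart R m N) u : 'rV[R]_m := w c u + v c u *m conn h c (alpha u) (v c u).

Let alpha_cvg u : I u -> alpha x @[x --> within I (nbhs u)] --> alpha u.
Proof. by move: u; apply/subspace_continuousP; exact: alpha_smooth.1. Qed.

Let beta_cvg u : I u -> beta x @[x --> within I (nbhs u)] --> beta u.
Proof. by move=> Iu; exact: (cvg_comp _ _ (alpha_cvg Iu) (iota_smooth.1 (alpha u))). Qed.

Let near_charts c d s : I s -> charts_at (alpha s) c -> charts_at (beta s) d ->
  \forall u \near within I (nbhs s), charts_at (alpha u) c /\ charts_at (beta u) d.
Proof.
move=> Is [cN cs] [dM ds]; apply: filterS (near_dom iota_smooth.1 (alpha_cvg Is) cs ds).
by move=> u [cu du]; split.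
Qed.

Let smooth_coord c u k j : I u -> charts_at (alpha u) c ->
  derivable_in I (iter k (derive_in I) (fun u => coord c (alpha u) 0 j)) u.
Proof. by move=> Iu cu; exact: (alpha_smooth.2 u c Iu cu j k). Qed.

Let vE c j : (fun x => v c x 0 j) = derive_in I (fun u => coord c (alpha u) 0 j).
Proof. by apply/funext => x; rewrite mxE. Qed.

Let d_coord c u : I u -> charts_at (alpha u) c ->
  mx_derive I (fun x => coord c (alpha x)) u (v c u).
Proof.
move=> Iu cu i j; rewrite (ord1 i) mxE; apply: derivable_in_has.
exact: (@smooth_coord _ _ 0 _ Iu cu).
Qed.

Let d_v c u : I u -> charts_at (alpha u) c -> mx_derive I (v c) u (w c u).
Proof.
move=> Iu cu i j; rewrite (ord1 i) mxE; apply: derivable_in_has.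
by rewrite vE; exact: (@smooth_coord _ _ 1 _ Iu cu).
Qed.

Let w_cvg c u : I u -> charts_at (alpha u) c -> w c x @[x --> within I (nbhs u)] --> w c u.
Proof.
move=> Iu cu; apply: cvg_mx => i j; rewrite (ord1 i).
under eq_cvg do rewrite mxE; rewrite mxE vE.
apply: has_derive_in_continuous; apply: derivable_in_has.
exact: (@smooth_coord _ _ 2 _ Iu cu).
Qed.

Let conn_cvg c u : I u -> charts_at (alpha u) c ->
  conn h c (alpha x) (v c x) @[x --> within I (nbhs u)] --> conn h c (alpha u) (v c u).
Proof.
move=> Iu cu; apply: cvg_mx => i j.
under eq_cvg do rewrite mxE; rewrite mxE; apply: cvg_fsum => r.
apply: cvgM; first exact: has_derive_in_continuous (@d_v c u Iu cu 0 r).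
have oU := @open_chart_image _ _ _ c.
have H := has_derive_in_comp oU Iu (smooth_christoffel h r i j cu.1 1)
  (image_coord cu.2) (@d_coord c u Iu cu 0).
have := has_derive_in_continuous H; rewrite coordK; last exact: cu.2.
apply: cvg_trans; apply: near_eq_cvg.
have : \forall x \near within I (nbhs u), dom c (alpha x).
  exact: alpha_cvg Iu _ (open_nbhs_nbhs (conj (@dom_open _ _ _ c) cu.2)).
by apply: filterS => x cx; rewrite coordK.
Qed.

(** The second part says that nabla_t t is tangent to N. *)
Lemma velocity_inclusion c d s : I s -> charts_at (alpha s) c -> charts_at (beta s) d ->
  velocity I beta s d = v c s *m jac iota c d (alpha s) /\
  cov_derive g I beta (velocity I beta) s d = q c s *m jac iota c d (alpha s).
Proof.
move=> Is cs ds.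
have nv : \forall u \near within I (nbhs s),
    mx_derive I (fun x => coord c (alpha x)) u (v c u).
  have := near_charts Is cs ds; rewrite !near_withinE.
  by apply: filterS => u cu Iu; have [? _] := cu Iu; exact: d_coord.
have [-> ->] := cov_derive_velocity_map h g iota_smooth I_interval Is alpha_cvg
  cs ds nv (d_v Is cs).
by rewrite second_form0// mulmx0 addr0.
Qed.

Variables (nu : 'I_m -> R -> tvec M) (kappa : 'I_m -> R -> R).
Hypothesis frame : rm_frame g I beta nu kappa.
Variable a : 'I_m -> R.

Let xi := frame_combination nu a.
Let k u := \sum_i a i * kappa i u.

Let F c d u : 'rV[R]_m := tangent_products iota g c d (alpha u) (xi u).

Let nu_derive i u d : I u -> charts_at (beta u) d ->
  exists nu', mx_derive I (fun x => nu i x d) u nu' /\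
    nu' + nu i u d *m conn g d (beta u) (velocity I beta u d) =
      - kappa i u *: velocity I beta u d.
Proof.
move=> Iu du; have [nus /(_ u d Iu du)[_ _ _ _ /(_ i) cov]] := frame.
have [_ /(_ d du) sm] := nus i u Iu.
exists (\row_j derive_in I (fun x => nu i x d 0 j) u).
have D : mx_derive I (fun x => nu i x d) u (\row_j derive_in I (fun x => nu i x d 0 j) u).
  by move=> b j; rewrite (ord1 b) mxE; apply: derivable_in_has; exact: (sm j 0%N).
by split=> //; rewrite -cov (cov_deriveE g I_interval Iu D erefl).
Qed.

Let xi_derive u d : I u -> charts_at (beta u) d ->
  exists xi', mx_derive I (fun x => xi x d) u xi' /\
    xi' + xi u d *m conn g d (beta u) (velocity I beta u d) =
      - k u *: velocity I beta u d.
Proof.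
move=> Iu du; have /choice[nu' nuP] i := nu_derive i Iu du.
exists (\sum_i a i *: nu' i); split.
  move=> b j; under [X in has_derive_in _ X]eq_fun do rewrite summxE.
  rewrite summxE; apply: has_derive_in_sum => i.
  under [X in has_derive_in _ X]eq_fun do rewrite mxE.
  rewrite mxE; apply: has_derive_inZ; exact: (nuP i).1.
rewrite /xi /frame_combination mulmx_suml -big_split/= /k -sumrN scaler_suml; apply: eq_bigr => i _.
by rewrite -scalemxAl -scalerDr (nuP i).2 scalerA mulrN.
Qed.

(* k = <nabla_t t, xi>, and nabla_t t is tangent to N with coordinates q. *)
Let k_normal c d s : I s -> charts_at (alpha s) c -> charts_at (beta s) d ->
  k s = (F c d s *m (q c s)^T) 0 0.
Proof.
move=> Is cs ds; have [_ /(_ s d Is ds)[_ _ on cov _]] := frame.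
have [_ acc] := velocity_inclusion Is cs ds.
rewrite /F /tangent_products -mulmxA -trmx_mul -acc cov linear_sum/= mulmx_sumr summxE.
apply: eq_bigr => j _; rewrite linearZ/= -scalemxAr mxE.
rewrite /xi /frame_combination !mulmx_suml summxE.
rewrite (bigD1 j)//= -!scalemxAl mxE.
have onE i i' :
  (nu i s d *m gram g d (beta s) *m (nu i' s d)^T) 0 0 = (i == i')%:R by exact: on.
rewrite onE eqxx mulr1 big1 ?addr0 1?mulrC// => i ij.
by rewrite -!scalemxAl mxE onE (negPf ij) mulr0.
Qed.

(* The matrix of the system satisfied by F: the first term comes from the
   derivatives of the coordinate vectors, the second from nabla_t xi = - k t. *)
Let B c u : 'M[R]_m :=
  (conn h c (alpha u) (v c u))^T - (q c u)^T *m (v c u *m gram h c (alpha u)).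

Let F_derive c d s : I s -> charts_at (alpha s) c -> charts_at (beta s) d ->
  mx_derive I (F c d) s (F c d s *m B c s).
Proof.
move=> Is cs ds; have [xi' [dxi nxi]] := xi_derive Is ds.
have [vel acc] := velocity_inclusion Is cs ds.
have [fc fs] := iota_smooth; have fcd := fs c d cs.1 ds.1.
have dE := mx_derive_jac fc fcd Is cs.2 ds.2 (d_coord Is cs).
have dz := mx_derive_coord_map fc fcd Is (alpha_cvg Is) cs.2 ds.2 (d_coord Is cs).
have := @metric_compat _ _ _ g _ _ _ _ _ Is (beta_cvg Is) ds dz _ _ _ _ _ _ dxi dE.
congr mx_derive; rewrite -vel nxi.
have /eqP := second_form0 (v c s) cs ds; rewrite /second_form subr_eq0 -vel => /eqP ->.
have E1 : v c s *m jac iota c d (alpha s) *m gram g d (beta s) *m (jac iota c d (alpha s))^T =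
    v c s *m gram h c (alpha s) by rewrite (h_induced cs ds) !mulmxA.
have FE : xi s d *m gram g d (beta s) *m (jac iota c d (alpha s))^T = F c d s by [].
rewrite vel -!scalemxAl E1 trmx_mul mulmxA FE /B mulmxBr (mulmxA (F c d s) (q c s)^T).
by rewrite [F c d s *m (q c s)^T]mx11_scalar -(k_normal Is cs ds) mul_scalar_mx addrC scaleNr.
Qed.

Let B_cvg c s : I s -> charts_at (alpha s) c -> B c u @[u --> within I (nbhs s)] --> B c s.
Proof.
move=> Is cs.
have trc p r (X : R -> 'M[R]_(p, r)) (l : 'M[R]_(p, r)) :
    X u @[u --> within I (nbhs s)] --> l ->
    (X u)^T @[u --> within I (nbhs s)] --> l^T.
  move=> Xl; apply: (cvg_mx (within_filter I (nbhs_filter s))) => i j; rewrite mxE.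
  have H := @cvg_entry _ _ _ _ _ _ _ j i Xl.
  by apply: cvg_trans H; apply: near_eq_cvg; apply: nearW => u; rewrite mxE.
have vc : v c u @[u --> within I (nbhs s)] --> v c s.
  exact: mx_derive_continuous (d_v Is cs).
have qc : q c u @[u --> within I (nbhs s)] --> q c s.
  by apply: cvgD; [exact: w_cvg|apply: cvg_mulmx => //; exact: conn_cvg].
apply: cvgB; first by apply: trc; exact: conn_cvg.
apply: cvg_mulmx; first exact: trc.
apply: cvg_mulmx => //.
exact: mx_derive_continuous (@mx_derive_gram _ _ _ h _ _ _ _ _ Is
  (alpha_cvg Is) cs (d_coord Is cs)).
Qed.


(* Normality may be tested in any pair of charts. *)
Let F_change c d c' d' u : I u -> charts_at (alpha u) c -> charts_at (beta u) d ->
  charts_at (alpha u) c' -> charts_at (beta u) d' ->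
  F c' d' u = F c d u *m (jac id c' c (alpha u))^T.
Proof.
move=> Iu cu du cu' du'; have [idN sN] := smooth_map_id N; have [idM sM] := smooth_map_id M.
have [fc fs] := iota_smooth.
have J1 : jac iota c' d (alpha u) = jac id c' c (alpha u) *m jac iota c d (alpha u).
  by apply: (jac_comp idN fc (sN _ _ cu'.1 cu.1) (fs _ _ cu.1 du.1) cu'.2 cu.2 du.2).
have J2 : jac iota c' d' (alpha u) = jac iota c' d (alpha u) *m jac id d d' (beta u).
  by apply: (jac_comp fc idM (fs _ _ cu'.1 du.1) (sM _ _ du.1 du'.1) cu'.2 du.2 du'.2).
have xd : xi u d' = xi u d *m jac id d d' (beta u).
  rewrite /xi /frame_combination mulmx_suml; apply: eq_bigr => i _; rewrite -scalemxAl; congr (_ *: _).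
  by have [/(_ i u Iu)[tan _] _] := frame; exact: tan.
rewrite /F /tangent_products xd J2 J1 [gram g d _](gram_change g du du').
by rewrite !trmx_mul !mulmxA.
Qed.

Let normal u := normal_to iota g (alpha u) (xi u).

Lemma normal_in_charts c d u : I u -> charts_at (alpha u) c -> charts_at (beta u) d ->
  F c d u = 0 -> normal u.
Proof.
move=> Iu cu du F0 c' d' cu' du'; rewrite -/(F c' d' u).
by rewrite (F_change Iu cu du cu' du') F0 mul0mx.
Qed.

Let exists_charts u : exists c d, charts_at (alpha u) c /\ charts_at (beta u) d.
Proof.
have [c cN cu] := atlas_cover (alpha u); have [d dM du] := atlas_cover (beta u).
by exists c, d.
Qed.

(** Around each point, F solves a linear system with bounded coefficients in
    fixed charts, so that its zeros propagate in both directions. *)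
Lemma normal_transport s0 s : I s0 -> I s -> normal s0 -> normal s.
Proof.
move: s0 s; apply: interval_propagation; first exact: I_interval.1.
move=> s Is; have [c [d [cs ds]]] := exists_charts s.
have [K _ bd] := cvg_mx_bounded (within_filter I (nbhs_filter s)) (B_cvg Is cs).
have : \forall u \near within I (nbhs s),
    (charts_at (alpha u) c /\ charts_at (beta u) d) /\
    forall i j, `|B c u i j| <= K.
  by apply: filterI bd; exact: near_charts.
rewrite near_withinE => -[e /= e0 eP]; exists e => // x y Ix Iy sx sy Nx.
have [cx dx] := (eP x sx Ix).1; have [cy dy] := (eP y sy Iy).1.
apply: (normal_in_charts Iy cy dy); have Fx := Nx c d cx dx.
have Iitv := I_interval.1.
have main a' b' : I a' -> I b' -> `|s - a'| < e -> `|s - b'| < e -> a' <= b' ->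
    (F c d a' = 0 <-> F c d b' = 0).
  move=> Ia Ib sa sb ab.
  have mid u : a' <= u <= b' -> I u /\ `|s - u| < e.
    move=> aub; split; first exact: Iitv aub.
    move: sa sb aub; rewrite !ltr_norml => /andP[? ?] /andP[? ?] /andP[? ?].
    by apply/andP; split; lra.
  apply: (linear_ode_zero (B := B c) (K := K) Iitv Ia Ib ab).
    move=> u /mid[Iu su]; have [cu du] := (eP u su Iu).1; exact: F_derive.
  by move=> u i j /mid[Iu su]; have [_] := eP u su Iu; exact.
have [xy|yx] := leP x y; first by apply/(main x y).
by apply/(main y x) => //; exact: ltW.
Qed.

Lemma normal_curvature_relation s : I s -> normal s -> \sum_i a i * kappa i s = 0.
Proof.
move=> Is Ns; have [c [d [cs ds]]] := exists_charts s.
by rewrite -/(k s) (k_normal Is cs ds) /F (Ns c d cs ds) mul0mx mxE.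
Qed.

End AlongCurve.

Theorem theorem5 (R : realType) (m : nat)
    (M : manifold R m.+1) (g : metric M)
    (N : manifold R m) (iota : N -> M) (h : metric N)
    (N_sub : submanifold iota) (N_orientable : orientable N)
    (h_induced : induced_metric iota g h)
    (I : set R) (I_interval : nondegenerate_interval I)
    (alpha : R -> N) (alpha_smooth : smooth_curve I alpha)
    (alpha_unit : unit_speed g I (iota \o alpha))
    (nu : 'I_m -> R -> tvec M) (kappa : 'I_m -> R -> R)
    (frame : rm_frame g I (iota \o alpha) nu kappa)
    (N_geodesic : totally_geodesic iota g h) :
  exists a : 'I_m -> R,
    (exists i, a i != 0) /\
    forall s, I s -> \sum_(i < m) a i * kappa i s = 0.
Proof.
have [_ iota_smooth _] := N_sub.
have sf0 c d p v : charts_at p c -> charts_at (iota p) d -> second_form h g iota c d p v = 0.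
  exact: totally_geodesic_second_form.
have [_ [s0 [_ [Is0 _ _]]]] := I_interval.
have [c cN cs] := atlas_cover (alpha s0); have [d dM ds] := atlas_cover (iota (alpha s0)).
have c0 : charts_at (alpha s0) c by [].
have d0 : charts_at (iota (alpha s0)) d by [].
have [vel _] := velocity_inclusion iota_smooth sf0 I_interval alpha_smooth Is0 c0 d0.
set v := velocity I alpha s0 c in vel.
pose P : 'M[R]_m := \matrix_i tangent_products iota g c d (alpha s0) (nu i s0).
(* entry i of this column is <n_i, t> *)
have Pv : P *m v^T = 0.
  apply/row_matrixP => i; rewrite row_mul rowK row0 /tangent_products.
  apply/rowP => j; rewrite (ord1 j) [RHS]mxE -mulmxA -trmx_mul -vel.
  have [_ /(_ s0 d Is0 d0)[_ tn _ _ _]] := frame.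
  have := tn i; rewrite /inner => tni.
  have : (velocity I (iota \o alpha) s0 d *m gram g d (iota (alpha s0)) *m
      (nu i s0 d)^T)^T 0 0 = 0.
    by rewrite mxE tni.
  by rewrite !trmx_mul trmxK (gram_sym g d0) mulmxA.
have v0 : v != 0.
  apply/eqP => v0; have := alpha_unit s0 d Is0 d0.
  by rewrite /inner vel v0 !mul0mx mxE => /eqP; rewrite eq_sym oner_eq0.
(* P is singular; a vector b of its left kernel gives the constants a_i *)
have : kermx P != 0.
  rewrite kermx_eq0 row_free_unit; apply: contraNN v0 => PU.
  rewrite -(trmxK v) -[v^T](mulKmx PU) Pv mulmx0 trmx0//.
case/rowV0Pn => b /sub_kermxP bP b0.
exists (fun i => b 0 i); split.
  by case/rV0Pn: b0 => i bi; exists i.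
move=> s Is; apply: (normal_curvature_relation iota_smooth sf0 I_interval alpha_smooth frame Is).
apply: (normal_transport iota_smooth h_induced sf0 I_interval alpha_smooth frame Is0 Is).
apply: (normal_in_charts iota_smooth frame Is0 c0 d0).
rewrite /tangent_products /frame_combination !mulmx_suml.
transitivity (b *m P); last by [].
rewrite mulmx_sum_row; apply: eq_bigr => i _.
by rewrite rowK /tangent_products -!scalemxAl.
Qed.
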